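(* Let $(F_i)_{i\in\mathbb{N}}$ be feedback functions $F_i\colon\mathbb{N}\to(0,\infty)$ and $(X_i(0))_{i\in\mathbb{N}}\subset\mathbb{N}$ initial values. Assume there is an infinite set $B\subset\mathbb{N}$ with $$\sum_{k=1}^\infty\sup_{i\in B}\frac{1}{F_i(k)}<\infty.$$ Then: 1. $\lim_{A\to\infty}\mathbb{P}\big(X^{(A)}_1(\infty)=X_1(0)\big)=1$. 2. If in addition $\limsup_{i\to\infty}F_i(X_i(0))<\infty$, then $\frac1A\#\{i\in[A]:X_i^{(A)}(\infty)=X_i(0)\}\to1$ in distribution as $A\to\infty$. 3. If in addition $\liminf_{i\to\infty}F_i(X_i(0))>0$ and $\lim_{i\to\infty}\frac1iF_i(X_i(0)+1)=0$, then $\#\{i\in[A]:X_i^{(A)}(\infty)\ne X_i(0)\}\to\infty$ in distribution as $A\to\infty$, i.e. for every $K\in\mathbb{N}$ the probability that this number is at least $K$ tends to $1$.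
   Context: $\mathbb{N}=\{1,2,\dots\}$, $[A]=\{1,\dots,A\}$, $e^{(i)}$ the $i$-th unit vector. Let $\Xi_1,\Xi_2,\dots$ be independent pure birth processes: $\Xi_i$ has independent sojourn times $\tau_i(k)$, $k\ge X_i(0)$, exponential with rate $F_i(k)$, and $\Xi_i(t)=\min\{k:\sum_{l=X_i(0)}^k\tau_i(l)>t\}$ (min of empty set $=\infty$). For each $A\ge2$, with $\Xi^{(A)}=(\Xi_1,\dots,\Xi_A)$, $t_0=0$, $t_{n+1}=\inf\{t>t_n:\Xi^{(A)}(t)\ne\Xi^{(A)}(t_n)\}$, the $A$-agent generalized Pólya urn is $X^{(A)}(n)=\Xi^{(A)}(t_n)$, a Markov chain with $\mathbb{P}(X^{(A)}(n+1)-X^{(A)}(n)=e^{(i)}\mid X^{(A)}(n))=F_i(X^{(A)}_i(n))/\sum_{j=1}^AF_j(X^{(A)}_j(n))$. $X_i^{(A)}(\infty)=\lim_{n\to\infty}X_i^{(A)}(n)\in\mathbb{N}\cup\{\infty\}$. $\mathbb{P}$ is the law of the sequence of birth processes. *)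

(* Defs.v *)
From HB Require Import structures.
From mathcomp Require Import all_boot all_order all_algebra.
From mathcomp Require Import all_classical all_reals all_analysis.
Set Implicit Arguments. Unset Strict Implicit. Unset Printing Implicit Defensive.
Import Order.TTheory GRing.Theory Num.Theory.
Local Open Scope classical_set_scope.
Local Open Scope ring_scope.

(** Values in N ∪ {∞} are represented by [option nat]: [Some k] = k, [None] = ∞. *)

Section Urn.
Context {R : realType}.

Definition jump_time (x0 : nat) (tau : nat -> R) (k : nat) : R :=
  \sum_(x0 <= l < k.+1) tau l.

Definition birth_proc (x0 : nat) (tau : nat -> R) (t : R) : option nat :=
  match pselect (exists k, (x0 <= k)%N && (t < jump_time x0 tau k)) with
  | left H => Some (ex_minn H)
  | right _ => None
  end.

Fixpoint urn_time (A : nat) (Xi : nat -> R -> option nat) (n : nat) : R :=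
  match n with
  | 0 => 0
  | n'.+1 =>
      let s := urn_time A Xi n' in
      inf [set t | s < t /\ exists i, (1 <= i <= A)%N /\ Xi i t <> Xi i s]
  end.

Definition urn (A : nat) (Xi : nat -> R -> option nat) (n i : nat) : option nat :=
  Xi i (urn_time A Xi n).

End Urn.

(** Limit in N ∪ {∞} of a (nondecreasing) sequence: [Some k] if eventually equal
    to [k], [None] (= ∞) otherwise. *)
Definition lim_optnat (u : nat -> option nat) : option nat :=
  match pselect (exists k, exists N, forall n, (N <= n)%N -> u n = Some k) with
  | left H => Some (projT1 (cid H))
  | right _ => None
  end.

Section Model.
Context {d : measure_display} {T : measurableType d} {R : realType}
  (P : probability T R).

Definition mutually_independent (I : eqType) (J : set I) (X : I -> {RV P >-> R}) :=
  forall (s : seq I) (B : I -> set R),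
    uniq s -> (forall j, j \in s -> J j) -> (forall j, measurable (B j)) ->
    P (\bigcap_(j in [set` s]) (X j @^-1` B j)) =
    (\prod_(j <- s) P (X j @^-1` B j))%E.

End Model.
Arguments mutually_independent {d T R} P {I} J X.

Definition urn_limit {R : realType} (X0 : nat -> nat) (tau : nat -> nat -> R)
  (A i : nat) : option nat :=
  lim_optnat (fun n => urn A (fun j => birth_proc (X0 j) (tau j)) n i).

Definition n_stuck {R : realType} (X0 : nat -> nat) (tau : nat -> nat -> R)
  (A : nat) : nat :=
  \sum_(1 <= i < A.+1) (urn_limit X0 tau A i == Some (X0 i)).

Definition n_moved {R : realType} (X0 : nat -> nat) (tau : nat -> nat -> R)
  (A : nat) : nat :=
  \sum_(1 <= i < A.+1) (urn_limit X0 tau A i != Some (X0 i)).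

(* Main.v *)
Require Import Defs.
From HB Require Import structures.
From mathcomp Require Import all_boot all_order all_algebra.
From mathcomp Require Import all_classical all_reals all_analysis.
From mathcomp Require Import measurable_realfun.
From mathcomp Require Import ring lra zify.
Set Implicit Arguments.
Unset Strict Implicit.
Unset Printing Implicit Defensive.
Import Order.TTheory GRing.Theory Num.Theory.
Import numFieldNormedType.Exports.
Local Open Scope classical_set_scope.
Local Open Scope ring_scope.

(** In continuous time the urn runs up to the first explosion among the agents
    in [{1, .., A}], and an agent is stuck iff its first sojourn outlasts that explosion.

    Explosions come early.  Given [eps], choose [K] such that, uniformly over [B],
    the sojourns in states [>= K] have small total mean, and [eta] with
    [K * eta = eps / 2].  Infinitely many agents of [B] start fast (sojourns below
    [K] at most [eta]), as these events are independent with probability bounded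
    below; each of them explodes before [eps] up to a small conditional
    probability.  Only pairwise independence of the fast starts and independence
    of a fast start from a single later sojourn are used.  Parts 1 and 2 follow
    since the first sojourn of [i] is at most [eps] with probability at most
    [F i (X0 i) * eps].

    For part 3, choose [eps] such that the mean number of agents of [{1, .., A}] whose
    first sojourn is at most [eps] equals a large constant [L].  Then [eps] is of
    order [1 / A], so the mean number of agents jumping twice before [eps]
    vanishes; when nobody does so, nobody has exploded by time [eps] and all
    agents that jumped before [eps] are moved. *)

(** * Birth processes and jump times of the urn *)

Section BirthProcess.
Context {R : realType}.
Implicit Types (tau : nat -> R) (s t : R).

(** Sojourns carry no sign condition here, so jump times need not be monotone and minimality of [k]
    is stated against all earlier [l]. *)
Lemma birth_procP x0 tau t k :
  birth_proc x0 tau t = Some k <->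
  [/\ (x0 <= k)%N, t < jump_time x0 tau k &
      forall l, (x0 <= l < k)%N -> jump_time x0 tau l <= t].
Proof.
rewrite /birth_proc; case: pselect => [H|nH]; last first.
  by split => // -[x0k tk _]; exfalso; apply: nH; exists k; rewrite x0k tk.
case: ex_minnP => m /andP[x0m tm] mmin; split => [[<-]|[x0k tk kmin]].
  split => // l /andP[x0l lm]; rewrite leNgt; apply/negP => tl.
  by have := mmin l; rewrite x0l tl => /(_ isT); rewrite leqNgt lm.
congr Some; apply/eqP; rewrite eqn_leq mmin ?x0k// leqNgt; apply/negP => mk.
by move: tm; rewrite ltNge kmin// x0m.
Qed.

Lemma birth_proc_ge x0 tau t k : birth_proc x0 tau t = Some k -> (x0 <= k)%N.
Proof. by move=> /birth_procP[]. Qed.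

Lemma birth_proc_lt x0 tau t k :
  birth_proc x0 tau t = Some k -> t < jump_time x0 tau k.
Proof. by move=> /birth_procP[]. Qed.

Lemma birth_proc_NoneP x0 tau t :
  birth_proc x0 tau t = None <->
  forall k, (x0 <= k)%N -> jump_time x0 tau k <= t.
Proof.
rewrite /birth_proc; case: pselect => [ex|nH].
  by split => // H; have [k /andP[x0k tk]] := ex; have := H k x0k; rewrite leNgt tk.
split => // _ k x0k; rewrite leNgt; apply/negP => tk.
by apply: nH; exists k; rewrite x0k tk.
Qed.

Lemma birth_proc_finite x0 tau t k : (x0 <= k)%N -> t < jump_time x0 tau k ->
  exists l, birth_proc x0 tau t = Some l.
Proof.
move=> x0k tk; case E : birth_proc => [l|]; first by exists l.
by have := (birth_proc_NoneP _ _ _).1 E k x0k; rewrite leNgt tk.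
Qed.

(** The conditions on earlier jump times pass from [s] to [t], so the value changes only once the
    pending jump time is reached; an exploded process stays at infinity. *)
Lemma birth_proc_jump x0 tau s t : s < t ->
  birth_proc x0 tau t <> birth_proc x0 tau s <->
  exists2 k, birth_proc x0 tau s = Some k & jump_time x0 tau k <= t.
Proof.
move=> st; case E : (birth_proc x0 tau s) => [k|]; split.
- move=> tk; exists k => //; rewrite leNgt; apply/negP => tk'; apply: tk.
  apply/birth_procP; have [x0k _ kmin] := (birth_procP _ _ _ _).1 E.
  by split => // l /kmin/le_trans; apply; exact: ltW.
- by move=> [_ [<-]] kt /birth_proc_lt; rewrite ltNge kt.
- move=> N; exfalso; apply: N; apply/birth_proc_NoneP => k x0k.
  by apply: le_trans (ltW st); exact: (birth_proc_NoneP _ _ _).1 E k x0k.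
- by case.
Qed.

Lemma jump_time_start x0 tau : jump_time x0 tau x0 = tau x0.
Proof. by rewrite /jump_time big_nat1. Qed.

Lemma jump_timeS x0 tau k : (x0 <= k)%N ->
  jump_time x0 tau k.+1 = jump_time x0 tau k + tau k.+1.
Proof. by move=> x0k; rewrite /jump_time big_nat_recr// ltnW. Qed.

Lemma jump_time_homo x0 tau k l : (forall m, (x0 <= m)%N -> 0 < tau m) ->
  (x0 <= k <= l)%N -> jump_time x0 tau k <= jump_time x0 tau l.
Proof.
move=> tau0 /andP[x0k]; elim: l => [|l IH]; first by rewrite leqn0 => /eqP ->.
rewrite leq_eqVlt => /predU1P[->//|]; rewrite ltnS => kl.
rewrite jump_timeS ?(leq_trans x0k)// (le_trans (IH kl))//.
by rewrite lerDl ltW// tau0// (leq_trans x0k)// (leq_trans kl).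
Qed.

End BirthProcess.

(** * The clock of the urn and the fate of single agents *)

Section UrnTime.
Context {R : realType} (x0 : nat -> nat) (tau : nat -> nat -> R) (A : nat).

Local Notation Xi := (fun i => birth_proc (x0 i) (tau i)).
Local Notation tm := (urn_time A Xi).
Local Notation jt i := (jump_time (x0 i) (tau i)).

Let pending n : set (nat * nat) :=
  [set ik | (1 <= ik.1 <= A)%N /\ urn A Xi n ik.1 = Some ik.2].

(** The times after [tm n] at which some agent has changed form a union of rays, one starting at
    each pending jump time. *)
Lemma urn_timeS n :
  tm n.+1 = inf [set t | exists2 ik, pending n ik & jt ik.1 ik.2 <= t].
Proof.
rewrite /=; congr inf; apply/seteqP; split => t /=.
  move=> [st [i [iA /(birth_proc_jump _ _ st)[k ik kt]]]].
  by exists (i, k).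
move=> [[i k] [/= iA ik] kt].
have st : tm n < t by rewrite (lt_le_trans _ kt)//; exact: birth_proc_lt.
by split => //; exists i; split => //; apply/(birth_proc_jump _ _ st); exists k.
Qed.

(* Junk value: [inf set0 = 0], so the clock is reset once every agent has exploded. *)
Lemma urn_timeS_exploded n :
  (forall i, (1 <= i <= A)%N -> urn A Xi n i = None) -> tm n.+1 = 0.
Proof.
move=> nA; rewrite urn_timeS [X in inf X](_ : _ = set0) ?inf0//.
by apply/seteqP; split => // t [[i k] [/= iA]]; rewrite nA.
Qed.

Lemma urn_timeS_le n i k : (1 <= i <= A)%N -> urn A Xi n i = Some k ->
  tm n.+1 <= jt i k.
Proof.
move=> iA ik; rewrite urn_timeS; apply: ge_inf; last by exists (i, k).
exists (tm n) => t [[j l] [_ /= jl] lt].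
by apply: ltW; apply: lt_le_trans lt; exact: birth_proc_lt.
Qed.

(* Only finitely many jumps are pending, so the infimum is attained. *)
Lemma urn_timeS_attained n :
  (exists i, (1 <= i <= A)%N /\ urn A Xi n i <> None) ->
  exists i k, [/\ (1 <= i <= A)%N, urn A Xi n i = Some k & tm n.+1 = jt i k].
Proof.
move=> [i [iA iN]].
pose f (j : 'I_A.+1) := jt j (odflt 0%N (urn A Xi n j)).
pose Pr := [pred j : 'I_A.+1 | (0 < j)%N && (urn A Xi n j != None)].
have iA' : (i < A.+1)%N by case/andP : iA.
have Pi : Pr (Ordinal iA') by rewrite inE/=; move: iA => /andP[-> _]; exact/eqP.
have := @Order.TotalTheory.arg_minP _ _ _ (Ordinal iA') Pr f Pi.
move=> [j /andP[j0 jN] jmin].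
case E : (urn A Xi n j) jN => [k|//] _.
have jA : (1 <= j <= A)%N by rewrite j0 -ltnS ltn_ord.
exists j, k; split => //.
apply/le_anti/andP; split; first exact: urn_timeS_le.
rewrite urn_timeS; apply: lb_le_inf.
  by exists (jt j k), (nat_of_ord j, k).
move=> t [[m l] [/= mA ml] lt]; apply: le_trans lt.
have mA' : (m < A.+1)%N by case/andP : mA.
have := jmin (Ordinal mA'); rewrite inE/= ml/= /f/= ml E/=; apply.
by rewrite andbT; case/andP : mA.
Qed.

(** A form suited to measurability: a countable union over agents and states, plus the junk case in
    which the clock is [0]. *)
Lemma urn_timeS_lt n (c : R) : tm n.+1 < c <->
  (exists i k, [/\ (1 <= i <= A)%N, urn A Xi n i = Some k & jt i k < c]) \/
  ((forall i, (1 <= i <= A)%N -> urn A Xi n i = None) /\ 0 < c).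
Proof.
split => [tc|[[i [k [iA ik kc]]]|[nA c0]]].
- have [ex|nex] := pselect (exists i, (1 <= i <= A)%N /\ urn A Xi n i <> None).
    left; have [i [k [iA ik E]]] := urn_timeS_attained ex.
    by exists i, k; split => //; rewrite -E.
  have nA i : (1 <= i <= A)%N -> urn A Xi n i = None.
    by move=> iA; apply: contrapT => iN; apply: nex; exists i.
  by right; split => //; rewrite -(urn_timeS_exploded nA).
- by rewrite (le_lt_trans _ kc)// urn_timeS_le.
- by rewrite urn_timeS_exploded.
Qed.

Hypothesis tau_gt0 : forall i k, (1 <= i <= A)%N -> (x0 i <= k)%N -> 0 < tau i k.

(** The next clock value is at most the pending jump time of [i], which positive sojourns place
    strictly below the jump time after it. *)
Lemma urn_finite n i : (1 <= i <= A)%N -> exists k, urn A Xi n i = Some k.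
Proof.
elim: n i => [|n IH] i iA.
  apply: (@birth_proc_finite _ _ _ _ (x0 i)) => //=.
  by rewrite jump_time_start tau_gt0.
have [k ik] := IH i iA; have x0k := birth_proc_ge ik.
apply: (@birth_proc_finite _ _ _ _ k.+1); first exact: leqW.
rewrite (le_lt_trans (urn_timeS_le iA ik))// jump_timeS// ltrDl tau_gt0//.
exact: leqW.
Qed.

Lemma urn_timeS_gt n : (0 < A)%N -> tm n < tm n.+1.
Proof.
move=> A0; have [k k1] := @urn_finite n 1%N A0.
have [|i [l [iA il ->]]] := @urn_timeS_attained n; last exact: birth_proc_lt il.
by exists 1%N; rewrite k1.
Qed.

Lemma urn_time_homo n m : (0 < A)%N -> (n <= m)%N -> tm n <= tm m.
Proof.
move=> A0; elim: m => [|m IH]; first by rewrite leqn0 => /eqP ->.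
rewrite leq_eqVlt => /predU1P[->//|]; rewrite ltnS => /IH/le_trans; apply.
exact/ltW/urn_timeS_gt.
Qed.

(** Two eventual values agree at a common index, so the choice of witness does not matter. *)
Lemma lim_optnatP (u : nat -> option nat) k :
  lim_optnat u = Some k <-> exists N, forall n, (N <= n)%N -> u n = Some k.
Proof.
rewrite /lim_optnat; case: pselect => [H|nH]; last first.
  by split => // -[N uk]; exfalso; apply: nH; exists k, N.
case: cid => l [N uN] /=; split => [[<-]|[M uM]]; first by exists N.
by rewrite -(uN (maxn N M) (leq_maxl _ _)) (uM _ (leq_maxr _ _)).
Qed.

(** Agent [j] is in a finite state at every urn step, so the clock stays below its explosion, hence
    below [eps] and the first jump of [i]. *)
Lemma urn_limit_stuck i j (eps : R) : (1 <= i <= A)%N -> (1 <= j <= A)%N ->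
  (forall k, (x0 j <= k)%N -> jt j k <= eps) -> eps <= tau i (x0 i) ->
  urn_limit x0 tau A i = Some (x0 i).
Proof.
move=> iA jA jeps ieps; apply/lim_optnatP; exists 0%N => n _.
apply/birth_procP; split => //.
  have [k jk] := urn_finite n jA.
  rewrite jump_time_start (lt_le_trans (birth_proc_lt jk))//.
  by rewrite (le_trans _ ieps)// jeps//; exact: birth_proc_ge jk.
by move=> l /andP[/leq_ltn_trans/[apply]]; rewrite ltnn.
Qed.

(** If [i] were stuck, infinitely many urn steps would happen before [eps]; as nobody jumps twice by
    then, only [A] jump times are available. *)
Lemma urn_limit_moved i (eps : R) : (1 <= i <= A)%N ->
  (forall j, (1 <= j <= A)%N -> eps < jt j (x0 j).+1) -> tau i (x0 i) <= eps ->
  urn_limit x0 tau A i != Some (x0 i).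
Proof.
move=> iA jeps ieps; apply/eqP => /lim_optnatP[N uN].
have A0 : (0 < A)%N by case/andP : iA => /leq_trans; apply.
have tlt n : tm n < eps.
  rewrite (le_lt_trans (urn_time_homo A0 (leq_maxr N n)))//.
  apply: lt_le_trans ieps; rewrite -(jump_time_start (x0 i)).
  exact: birth_proc_lt (uN (maxn N n) (leq_maxl _ _)).
(* Each of the infinitely many jumps is the first jump of some agent. *)
have tin n : tm n.+1 \in [seq jt j (x0 j) | j <- iota 1 A].
  have [|j [k [jA jk tE]]] := @urn_timeS_attained n.
    by exists i; split => //; have [l ->] := urn_finite n iA.
  rewrite tE; have x0k := birth_proc_ge jk.
  suff -> : k = x0 j by apply/map_f; rewrite mem_iota addnC addn1 ltnS.
  apply/eqP; rewrite eqn_leq x0k andbT leqNgt; apply/negP => x0k'.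
  have := tlt n.+1; rewrite tE ltNge => /negP; apply.
  apply: ltW; apply: lt_le_trans (jeps _ jA) _.
  by apply: jump_time_homo; [move=> m; exact: tau_gt0 | rewrite leqnSn].
have mono : {homo tm : n m / (n < m)%N >-> n < m}.
  by move=> n m nm; apply: lt_le_trans (urn_timeS_gt n A0) (urn_time_homo A0 nm).
(* Pigeonhole: the strictly increasing clock yields [A.+1] distinct values in a list of length
   [A]. *)
have := @uniq_leq_size _ [seq tm n.+1 | n <- iota 0 A.+1]
  [seq jt j (x0 j) | j <- iota 1 A].
rewrite !size_map !size_iota ltnn => H; have // : false; apply: H.
  rewrite map_inj_uniq ?iota_uniq// => n m E; apply/eqP.
  by case: (ltngtP n m) => // nm; [have := mono n.+1 m.+1 | have := mono m.+1 n.+1];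
    rewrite E ltxx => /(_ nm).
by move=> _ /mapP[n _ ->].
Qed.

End UrnTime.

(** * Measurability *)

Section MeasurableEvents.
Context {d : measure_display} {T : measurableType d}.

Lemma measurable_prop (p : Prop) : measurable [set _ : T | p].
Proof.
have [h|h] := pselect p.
  by rewrite (_ : [set _ | _] = setT)//; apply/seteqP; split.
by rewrite (_ : [set _ | _] = set0)//; apply/seteqP; split.
Qed.

Lemma measurable_forall (Q : nat -> T -> Prop) :
  (forall n, measurable [set w | Q n w]) ->
  measurable [set w | forall n, Q n w].
Proof.
move=> mQ; rewrite (_ : [set _ | _] = \bigcap_n [set w | Q n w]).
  exact: bigcapT_measurable.
by apply/seteqP; split => w /= Qw n; [move=> _|]; exact: Qw.
Qed.

Lemma measurable_exists (Q : nat -> T -> Prop) :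
  (forall n, measurable [set w | Q n w]) ->
  measurable [set w | exists n, Q n w].
Proof.
move=> mQ; rewrite (_ : [set _ | _] = \bigcup_n [set w | Q n w]).
  exact: bigcupT_measurable.
by apply/seteqP; split => w [n]; exists n.
Qed.

Lemma measurable_imply (p : Prop) (Q : T -> Prop) :
  (p -> measurable [set w | Q w]) -> measurable [set w | p -> Q w].
Proof.
move=> mQ; have [h|h] := pselect p.
  by rewrite (_ : [set _ | _] = [set w | Q w]); [exact: mQ |
    apply/seteqP; split => w /=; [apply|]].
by rewrite (_ : [set _ | _] = setT)//; apply/seteqP; split => // w _ /h.
Qed.

Lemma measurable_set_lt {R : realType} (f g : T -> R) :
  measurable_fun setT f -> measurable_fun setT g ->
  measurable [set w | f w < g w].
Proof.
by move=> mf mg; have := measurable_fun_ltr mf mg measurableT (I : measurable [set true]);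
  rewrite setTI.
Qed.

Lemma measurable_set_le {R : realType} (f g : T -> R) :
  measurable_fun setT f -> measurable_fun setT g ->
  measurable [set w | f w <= g w].
Proof.
by move=> mf mg; have := measurable_fun_ler mf mg measurableT (I : measurable [set true]);
  rewrite setTI.
Qed.

End MeasurableEvents.

Section UrnMeasurable.
Context {d : measure_display} {T : measurableType d} {R : realType}.
Variables (x0 : nat -> nat) (tau : nat -> nat -> T -> R) (A : nat).
Hypothesis mtau : forall i k, measurable_fun setT (tau i k).

Local Notation Xi w := (fun i => birth_proc (x0 i) (fun k => tau i k w)).
Local Notation jt i k := (fun w => jump_time (x0 i) (fun k => tau i k w) k).

Lemma measurable_jump_time i k : measurable_fun setT (jt i k).
Proof. by apply: measurable_sum => l; exact: mtau. Qed.

(** The time is itself random, since the urn evaluates each process at its clock. *)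
Lemma measurable_birth_proc (t : T -> R) i k : measurable_fun setT t ->
  measurable [set w | Xi w i (t w) = Some k].
Proof.
move=> mt.
rewrite (_ : [set _ | _] = [set w | (x0 i <= k)%N] `&` [set w | t w < jt i k w] `&`
    [set w | forall l, (x0 i <= l < k)%N -> jt i l w <= t w]); last first.
  by apply/seteqP; split => w /=; rewrite birth_procP; [case|move=> [[]]].
apply: measurableI; first apply: measurableI.
- exact: measurable_prop.
- exact/measurable_set_lt/measurable_jump_time.
- apply: measurable_forall => l; apply: measurable_imply => _.
  exact/measurable_set_le/mt/measurable_jump_time.
Qed.

Lemma measurable_urn_time n :
  measurable_fun setT (fun w => urn_time A (Xi w) n).
Proof.
elim: n => [|n IH]; first exact: measurable_cst.
have mS i k : measurable [set w | urn A (Xi w) n i = Some k].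
  exact: measurable_birth_proc.
(* It suffices to treat the rays []-oo, c[]. That an agent has exploded is then written as the
   failure of all equations with [Some k], the events known to be measurable. *)
apply: (measurability _ (RGenInftyO.measurableE R)) => //= _ [_ [c ->] <-].
rewrite setTI (_ : _ @^-1` _ = [set w |
    exists i k, [/\ (1 <= i <= A)%N, urn A (Xi w) n i = Some k & jt i k w < c]] `|`
   ([set w | forall i, (1 <= i <= A)%N -> forall k, ~ urn A (Xi w) n i = Some k] `&`
    [set w | 0 < c])); last first.
  apply/seteqP; split => w /=; rewrite in_itv/= => H.
    have [//|[H1 H2]] := (urn_timeS_lt _ _ _ _ _).1 H; first by left.
    by right; split => // i iA k; rewrite H1.
  apply/(urn_timeS_lt _ _ _ _ _); case: H => [|[H1 H2]]; [by left|right; split => //].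
  by move=> i iA; case E : urn => [k|//]; case: (H1 i iA k).
apply: measurableU; last apply: measurableI; last exact: measurable_prop.
- apply: measurable_exists => i; apply: measurable_exists => k.
  rewrite (_ : [set _ | _] = [set w | (1 <= i <= A)%N] `&`
    [set w | urn A (Xi w) n i = Some k] `&` [set w | jt i k w < c]); last first.
    by apply/seteqP; split => w /=; [case|move=> [[]]].
  apply: measurableI; first exact: measurableI (measurable_prop _) (mS _ _).
  by apply: measurable_set_lt; [exact: measurable_jump_time|exact: measurable_cst].
- apply: measurable_forall => i; apply: measurable_imply => _.
  by apply: measurable_forall => k; exact/measurableC/mS.
Qed.

Lemma measurable_urn_limit i k :
  measurable [set w | urn_limit x0 (fun i k => tau i k w) A i = Some k].
Proof.
rewrite (_ : [set _ | _] = [set w | exists N, forall n, (N <= n)%N ->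
    urn A (Xi w) n i = Some k]); last first.
  by apply/seteqP; split => w /lim_optnatP.
apply: measurable_exists => N; apply: measurable_forall => n.
by apply: measurable_imply => _; exact/measurable_birth_proc/measurable_urn_time.
Qed.

End UrnMeasurable.

(** * Counting events, limits *)

Section RealProbability.
Context {d : measure_display} {T : measurableType d} {R : realType}.
Variable P : probability T R.
Local Notation pr E := (fine (P E)).

Lemma pr_fineK (E : set T) : measurable E -> (pr E)%:E = P E.
Proof. by move=> mE; rewrite fineK// fin_num_measure. Qed.

Lemma pr_ge0 (E : set T) : 0 <= pr E.
Proof. by rewrite fine_ge0. Qed.

Lemma pr_le1 (E : set T) : measurable E -> pr E <= 1.
Proof. by move=> mE; rewrite -lee_fin pr_fineK// probability_le1. Qed.

Lemma pr_le (E F : set T) : measurable E -> measurable F -> E `<=` F ->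
  pr E <= pr F.
Proof.
by move=> mE mF EF; rewrite -lee_fin !pr_fineK// le_measure// inE.
Qed.

Lemma pr_setU_le (E F : set T) : measurable E -> measurable F ->
  pr (E `|` F) <= pr E + pr F.
Proof.
move=> mE mF; rewrite -lee_fin EFinD !pr_fineK//; last exact: measurableU.
exact: measureU2.
Qed.

Lemma pr_setC (E : set T) : measurable E -> pr (~` E) = 1 - pr E.
Proof.
by move=> mE; rewrite probability_setC// -(pr_fineK mE) -EFinB.
Qed.

Lemma integral_sum_indic (I : Type) (s : seq I) (E : I -> set T) :
  (forall i, measurable (E i)) ->
  (\int[P]_w (\sum_(i <- s) \1_(E i) w)%:E = (\sum_(i <- s) pr (E i))%:E)%E.
Proof.
move=> mE; under eq_integral do rewrite -sumEFin.
rewrite ge0_integral_sum//; last first.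
  by move=> i; apply/measurable_EFinP; exact: measurable_indic.
rewrite -sumEFin; apply: eq_bigr => i _.
by rewrite integral_indic// setIT pr_fineK.
Qed.

Lemma measurable_count (I : Type) (s : seq I) (E : I -> set T) :
  (forall i, measurable (E i)) ->
  measurable_fun setT (fun w => \sum_(i <- s) \1_(E i) w : R).
Proof. by move=> mE; apply: measurable_sum => i; exact: measurable_indic. Qed.

(** Markov's inequality restricted to [D]: with [D] a fast start it replaces a conditional
    estimate. *)
Lemma markov_set (D : set T) (f : T -> \bar R) (a : R) : measurable D ->
  measurable_fun setT f -> (forall w, 0 <= f w)%E -> 0 < a ->
  (a%:E * P (D `&` [set w | a%:E <= f w]) <= \int[P]_(w in D) f w)%E.
Proof.
move=> mD mf f0 a0.
have := @le_integral_abse _ _ _ P _ mD f a (measurable_funTS mf) a0.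
under eq_set do rewrite gee0_abs//.
by under eq_integral do rewrite gee0_abs//.
Qed.

Lemma markov_count (I : Type) (s : seq I) (E : I -> set T) (a : R) :
  (forall i, measurable (E i)) -> 0 < a ->
  pr [set w | a <= \sum_(i <- s) \1_(E i) w] <= (\sum_(i <- s) pr (E i)) / a.
Proof.
move=> mE a0; rewrite ler_pdivlMr// mulrC -lee_fin EFinM -integral_sum_indic//.
have mN := measurable_count s mE.
rewrite pr_fineK; last by apply: measurable_set_le => //; exact: measurable_cst.
rewrite -[X in P X]setTI.
apply: (@markov_set setT (fun w => (\sum_(i <- s) \1_(E i) w)%:E)) => //.
- exact/measurable_EFinP.
- by move=> w; rewrite lee_fin sumr_ge0.
Qed.

(** Pairwise independence bounds the variance of the count by its mean [mu]; then Chebyshev's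
    inequality applies at distance [mu - c]. *)
Lemma chebyshev_count (I : eqType) (s : seq I) (E : I -> set T) (c : R) :
  uniq s -> (forall i, measurable (E i)) ->
  {in s &, forall i j, i != j -> pr (E i `&` E j) = pr (E i) * pr (E j)} ->
  let mu := \sum_(i <- s) pr (E i) in c < mu ->
  pr [set w | \sum_(i <- s) \1_(E i) w < c] <= mu / (mu - c) ^+ 2.
Proof.
move=> us mE Eind mu cmu.
pose N w : R := \sum_(i <- s) \1_(E i) w.
have mN : measurable_fun setT N by exact: measurable_count.
have N0 w : 0 <= N w by rewrite sumr_ge0.
have mu0 : 0 <= mu by rewrite sumr_ge0// => i _; exact: pr_ge0.
have mNmu : measurable_fun setT (fun w => (N w - mu) ^+ 2).
  apply: measurable_funX; apply: measurable_funB => //; exact: measurable_cst.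
have EN2 : (\int[P]_w ((N w) ^+ 2)%:E <= (mu ^+ 2 + mu)%:E)%E.
  (* The squared count is the sum of the indicators of all pairwise intersections. *)
  have -> : (\int[P]_w ((N w) ^+ 2)%:E =
      \int[P]_w (\sum_(ij <- [seq (i, j) | i <- s, j <- s])
        \1_(E ij.1 `&` E ij.2) w)%:E)%E.
    apply: eq_integral => w _; congr EFin.
    rewrite big_allpairs/= expr2 mulr_suml; apply: eq_bigr => i _.
    by rewrite mulr_sumr; apply: eq_bigr => j _; rewrite indicI.
  rewrite integral_sum_indic; last by move=> ij; exact: measurableI.
  rewrite lee_fin big_allpairs/= expr2 mulr_suml -big_split/=.
  rewrite big_seq [leRHS]big_seq; apply: ler_sum => i si.
  (* The diagonal pair contributes [pr (E i)], in total [mu]; the diagonal product on the right is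
     nonnegative and is dropped. *)
  rewrite (bigD1_seq i)//= setIid addrC lerD2r mulr_sumr.
  rewrite [leRHS](bigD1_seq i)//= big_seq_cond [X in _ <= _ + X]big_seq_cond.
  rewrite -[leLHS]add0r lerD ?mulr_ge0 ?pr_ge0//.
  by apply: ler_sum => j /andP[sj ji]; rewrite Eind// eq_sym.
have Var : (\int[P]_w ((N w - mu) ^+ 2)%:E <= mu%:E)%E.
  (* [(N - mu)^2 + 2 mu N = N^2 + mu^2] has nonnegative terms only, so no
     integrability is needed. *)
  have : (\int[P]_w ((N w - mu) ^+ 2)%:E + (2 * mu ^+ 2)%:E =
          \int[P]_w ((N w) ^+ 2)%:E + (mu ^+ 2)%:E)%E.
    have -> : ((2 * mu ^+ 2)%:E = \int[P]_w (2 * mu * N w)%:E)%E.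
      under eq_integral do rewrite EFinM.
      rewrite ge0_integralZl//.
      - by rewrite integral_sum_indic// -EFinM; congr EFin; rewrite -/mu; ring.
      - exact/measurable_EFinP.
      - by move=> w _; rewrite lee_fin.
      - by rewrite lee_fin mulr_ge0.
    have -> : ((mu ^+ 2)%:E = \int[P]_w (mu ^+ 2)%:E)%E.
      rewrite integral_cst//.
      by rewrite [X in (_ * X)%E](_ : _ = 1%E) ?mule1//; exact: probability_setT.
    rewrite -!ge0_integralD//.
    - by apply: eq_integral => w _; rewrite -!EFinD; congr EFin; ring.
    - by move=> w _; rewrite lee_fin sqr_ge0.
    - by apply/measurable_EFinP; exact: measurable_funX.
    - by move=> w _; rewrite lee_fin sqr_ge0.
    - by move=> w _; rewrite lee_fin sqr_ge0.
    - exact/measurable_EFinP.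
    - by move=> w _; rewrite lee_fin !mulr_ge0.
    - by apply/measurable_EFinP; apply: measurable_funM => //; exact: measurable_cst.
  move: EN2; set a := (X in (X <= _)%E); set b := (X in (X + _)%E) => EN2 ab.
  have {ab}ab : (b + (2 * mu ^+ 2)%:E <= (2 * mu ^+ 2 + mu)%:E)%E.
    rewrite ab (_ : (2 * mu ^+ 2 + mu) = mu ^+ 2 + mu + mu ^+ 2); last by ring.
    by rewrite EFinD leeD2r.
  by move: ab; rewrite EFinD [X in (_ <= X)%E]addeC leeD2rE.
have c0 : 0 < (mu - c) ^+ 2 by rewrite exprn_gt0// subr_gt0.
rewrite ler_pdivlMr// mulrC -lee_fin EFinM pr_fineK; last first.
  by apply: measurable_set_lt => //; exact: measurable_cst.
apply: le_trans Var.
(* A count below [c] deviates from [mu] by at least [mu - c], so Markov's inequality is applied to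
   the squared deviation. *)
apply: (@le_trans _ _ (((mu - c) ^+ 2)%:E *
    P (setT `&` [set w | ((mu - c) ^+ 2)%:E <= ((N w - mu) ^+ 2)%:E])))%E.
  rewrite lee_pmul2l// setTI le_measure// ?inE.
  - by apply: measurable_set_lt => //; exact: measurable_cst.
  - by apply: measurable_set_le => //; exact: measurable_cst.
  - move=> w /= Nc; rewrite lee_fin -(sqrrN (N w - mu)) opprB.
    by rewrite ler_pXn2r// ?nnegrE ?lerB// ?subr_ge0 ?ltW// (lt_trans Nc).
apply: markov_set => //; first exact/measurable_EFinP.
by move=> w; rewrite lee_fin sqr_ge0.
Qed.

End RealProbability.

(** * Exponential estimates, upper and lower limits *)

Lemma subr1_expRN_le {R : realType} (x : R) : 1 - expR (- x) <= x.
Proof. by have := expR_ge1Dx (- x); lra. Qed.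

(** From [1 + x <= expR x] follows [expR (- x) <= 1 / (1 + x)], and [x / (1 + x) >= x / 2] for
    [x <= 1]. *)
Lemma subr1_expRN_ge {R : realType} (x : R) : 0 <= x <= 1 ->
  x / 2 <= 1 - expR (- x).
Proof.
move=> /andP[x0 x1]; have := expR_ge1Dx x; have := expRxMexpNx_1 x.
by have := expR_gt0 (- x); nra.
Qed.

Section Limits.
Context {R : realType}.

Lemma limn_esup_lt (u : (\bar R)^nat) (y : \bar R) : (limn_esup u < y)%E ->
  exists2 x, (x < y)%E & exists N, forall n, (N <= n)%N -> (u n <= x)%E.
Proof.
rewrite /limn_esup /limf_esup => /ereal_inf_lt[_ [V [N _ NV] <-] Vy].
exists (ereal_sup (u @` V)) => //; exists N => n Nn.
by apply: ereal_sup_ubound; exists n => //; exact: NV.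
Qed.

Lemma eventually_le_of_limn_esup (u : nat -> R) :
  (limn_esup (fun i => (u i)%:E) < +oo)%E ->
  exists M N, 0 < M /\ forall n, (N <= n)%N -> u n <= M.
Proof.
move=> /limn_esup_lt[[x| |]//]; last first.
  by move=> _ [N H]; have := H N (leqnn N); rewrite leeNy_eq.
move=> _ [N H]; exists (Num.max x 1), N; split; first by rewrite lt_max ltr01 orbT.
by move=> n /H; rewrite lee_fin le_max => ->.
Qed.

Lemma eventually_ge_of_limn_einf (u : nat -> R) :
  (0 < limn_einf (fun i => (u i)%:E))%E ->
  exists c N, 0 < c /\ forall n, (N <= n)%N -> c <= u n.
Proof.
rewrite /limn_einf oppe_gt0 => /limn_esup_lt[[x| |]//]; last first.
  by move=> _ [N H]; have := H N (leqnn N); rewrite leeNy_eq.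
rewrite lte_fin => x0 [N H]; exists (- x), N; split; first by rewrite oppr_gt0.
by move=> n /H; rewrite lee_fin lerNl.
Qed.

(** Bounding by [minn N A] instead of [N] makes the induction go through. *)
Lemma sum_ltn_le (N A : nat) : (\sum_(1 <= i < A.+1) (i < N) <= minn N A)%N.
Proof.
elim: A => [|A IH]; first by rewrite big_geq.
by rewrite big_nat_recr//=; case: (ltnP A.+1 N) => NA /=; move: IH; lia.
Qed.

(** Intermediate value theorem: for rates [u] the sum is the mean number of first jumps by time [e],
    which is continuous in [e] and vanishes at [0]. *)
Lemma sum_subr1_expRN_attains (c L : R) (N A : nat) (u : nat -> R) :
  0 < c -> 0 < L -> (forall i, (0 < i)%N -> 0 < u i) ->
  (forall i, (N <= i)%N -> c <= u i) -> (2 * N <= A)%N -> 4 * L <= A%:R ->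
  exists e, [/\ 0 <= e, e <= 4 * L / (c * A%:R) &
    \sum_(1 <= i < A.+1) (1 - expR (- (u i * e))) = L].
Proof.
move=> c0 L0 u0 cu NA LA.
have A0 : 0 < A%:R :> R by rewrite (lt_le_trans _ LA)// mulr_gt0.
have A0' : (0 < A)%N by move: A0; rewrite ltr0n.
pose f (e : R) : R := \sum_(1 <= i < A.+1) (1 - expR (- (u i * e))).
(* Here [c * m = 4 * L / A <= 1], so each of the at least [A / 2] indices beyond [N] contributes at
   least [c * m / 2 = 2 * L / A], in total at least [L]. *)
pose m := 4 * L / (c * A%:R).
have m0 : 0 <= m by rewrite divr_ge0 ?mulr_ge0// ltW.
have term0 i e : (0 < i)%N -> 0 <= e -> 0 <= 1 - expR (- (u i * e)).
  by move=> i0 e0; rewrite subr_ge0 expR_le1 oppr_le0 mulr_ge0// ltW// u0.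
have f0 : f 0 = 0.
  by rewrite /f big1// => i _; rewrite mulr0 oppr0 expR0 subrr.
have fm : L <= f m.
  rewrite /f (@big_cat_nat _ _ _ N.+1)//=; last by lia.
  apply: ler_wpDl.
    by rewrite big_nat_cond sumr_ge0// => i /andP[/andP[i0 _] _]; exact: term0.
  apply: (@le_trans _ _ (\sum_(N.+1 <= i < A.+1) (2 * L / A%:R))).
    rewrite big_const_nat iter_addr_0 subSS -[leRHS]mulr_natl.
    rewrite mulrA ler_pdivlMr// natrB; last by lia.
    have : 2 * N%:R <= A%:R :> R by rewrite -natrM ler_nat.
    by nra.
  rewrite [leLHS]big_nat_cond [leRHS]big_nat_cond; apply: ler_sum => i /andP[/andP[Ni _] _].
  have cm : c * m = 4 * L / A%:R by rewrite /m; field; rewrite !gt_eqF.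
  apply: (@le_trans _ _ (1 - expR (- (c * m)))).
    rewrite (_ : 2 * L / A%:R = c * m / 2); last by rewrite cm; field; rewrite gt_eqF.
    apply: subr1_expRN_ge; rewrite mulr_ge0 ?(ltW c0)//= cm ler_pdivrMr//.
    by rewrite mul1r.
  by rewrite lerD2l lerN2 ler_expR lerN2 ler_wpM2r// cu// ltnW.
have fc : {within `[0, m], continuous f}.
  apply: continuous_subspaceT => x; rewrite /f.
  apply: cvg_big => [|i _]; first exact: add_continuous.
  apply: cvgB; first exact: cvg_cst.
  apply: (@continuous_comp _ _ _ (fun e => - (u i * e)) expR).
    by apply: cvgN; apply: cvgMr; exact: cvg_id.
  exact: continuous_expR.
have : Num.min (f 0) (f m) <= L <= Num.max (f 0) (f m).
  by rewrite f0 ge_min (ltW L0) le_max fm orbT.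
move=> /(IVT m0 fc)[e]; rewrite in_itv/= => /andP[e0 em] fe.
by exists e.
Qed.

End Limits.

Section ProbabilityLimits.
Context {d : measure_display} {T : measurableType d} {R : realType}.
Variable P : probability T R.
Local Notation pr E := (fine (P E)).

Lemma cvg_pr0 (E : nat -> set T) : (forall A, measurable (E A)) ->
  (forall gam, 0 < gam -> exists A0, forall A, (A0 <= A)%N -> pr (E A) <= gam) ->
  (fun A => P (E A)) @ \oo --> 0%E.
Proof.
move=> mE small; rewrite (_ : (fun A => P (E A)) = EFin \o (fun A => pr (E A))).
  apply: cvg_EFin; first by apply: nearW.
  apply/cvgrPdist_le => /= gam gam0; have [A0 HA] := small gam gam0.
  by exists A0 => // A /= AA; rewrite sub0r normrN ger0_norm ?pr_ge0// HA.
by apply/funext => A /=; rewrite pr_fineK.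
Qed.

Lemma cvg_pr1 (E : nat -> set T) : (forall A, measurable (E A)) ->
  (forall gam, 0 < gam ->
     exists A0, forall A, (A0 <= A)%N -> pr (~` E A) <= gam) ->
  (fun A => P (E A)) @ \oo --> 1%E.
Proof.
move=> mE small; rewrite (_ : (fun A => P (E A)) = EFin \o (fun A => pr (E A))).
  apply: cvg_EFin; first by apply: nearW.
  apply/cvgrPdist_le => /= gam gam0; have [A0 HA] := small gam gam0.
  exists A0 => // A /= AA.
  by rewrite -pr_setC// ger0_norm ?pr_ge0// HA.
by apply/funext => A /=; rewrite pr_fineK.
Qed.

End ProbabilityLimits.

(** * Exponential clocks *)

Section Model.
Context {d : measure_display} {T : measurableType d} {R : realType}.
Variables (P : probability T R) (F : nat -> nat -> R) (X0 : nat -> nat).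
Variable tau : nat -> nat -> {RV P >-> R}.
Hypothesis HF : forall i k, (0 < i)%N -> (0 < k)%N -> 0 < F i k.
Hypothesis HX0 : forall i, (0 < i)%N -> (0 < X0 i)%N.
Hypothesis Hexp : forall i k, (0 < i)%N -> (X0 i <= k)%N ->
  forall U : set R, measurable U ->
  distribution P (tau i k) U = exponential_prob (F i k) U.
Hypothesis Hind : mutually_independent P
  [set jk : nat * nat | (0 < jk.1)%N /\ (X0 jk.1 <= jk.2)%N]
  (fun jk => tau jk.1 jk.2).

Local Notation pr E := (fine (P E)).
Local Notation clocks w := (fun i k => tau i k w).

Lemma measurable_tau i k : measurable_fun setT (tau i k).
Proof. exact: measurable_funPT. Qed.

Lemma measurable_tau_le i k x : measurable [set w | tau i k w <= x].
Proof. exact: measurable_set_le (measurable_tau i k) (measurable_cst _). Qed.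

Lemma measurable_tau_gt i k x : measurable [set w | x < tau i k w].
Proof. exact: measurable_set_lt (measurable_cst _) (measurable_tau i k). Qed.

Let F_gt0 i k : (0 < i)%N -> (X0 i <= k)%N -> 0 < F i k.
Proof. by move=> i0 ik; rewrite HF// (leq_trans _ ik)// HX0. Qed.

Lemma pr_tau_lt0 i k : (0 < i)%N -> (X0 i <= k)%N ->
  P (tau i k @^-1` `]-oo, 0[) = 0%E.
Proof.
move=> i0 ik; have := Hexp i0 ik (measurable_itv `]-oo, 0[).
rewrite /distribution/= /pushforward => ->.
rewrite /exponential_prob; apply: integral0_eq => x /=.
by rewrite in_itv/= => x0; rewrite lt0_exponential_pdf.
Qed.

Lemma pr_tau_le_gt0 i k x : (0 < i)%N -> (X0 i <= k)%N -> 0 < x ->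
  pr [set w | tau i k w <= x] = 1 - expR (- (F i k * x)).
Proof.
move=> i0 ik x0.
have -> : [set w | tau i k w <= x] =
    (tau i k @^-1` `[0, x]) `|` (tau i k @^-1` `]-oo, 0[).
  apply/seteqP; split => w /=; rewrite !in_itv/=.
    by case: (leP 0 (tau i k w)) => [_ ->|]; [left|right].
  by move=> [/andP[]//|/ltW/le_trans]; apply; exact: ltW.
have mpre U : measurable U -> measurable (tau i k @^-1` U).
  by move=> mU; rewrite -[_ @^-1` _]setTI; exact: measurable_tau.
rewrite measureU0; [| exact: mpre | exact: mpre | exact: pr_tau_lt0].
have := Hexp i0 ik (measurable_itv `[0, x]).
rewrite /distribution/= /pushforward => ->.
by rewrite exponential_prob_itv0c// -EFinB/= mulNr.
Qed.

(** Only [x = 0] is new: for every [e > 0] the event lies in [tau i k <= e / F i k], whose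
    probability is at most [e]. *)
Lemma pr_tau_le i k x : (0 < i)%N -> (X0 i <= k)%N -> 0 <= x ->
  pr [set w | tau i k w <= x] = 1 - expR (- (F i k * x)).
Proof.
move=> i0 ik; rewrite le_eqVlt => /predU1P[<-|]; last exact: pr_tau_le_gt0.
rewrite mulr0 oppr0 expR0 subrr; apply/le_anti; rewrite pr_ge0 andbT.
apply/ler_addgt0Pl => e e0; rewrite addr0.
have Fe : 0 < e / F i k by rewrite divr_gt0// F_gt0.
apply: (@le_trans _ _ (pr [set w | tau i k w <= e / F i k])).
  by apply: pr_le; [exact: measurable_tau_le..|move=> w /= /le_trans; apply; exact: ltW].
rewrite pr_tau_le_gt0// mulrCA divff ?gt_eqF ?F_gt0// mulr1.
exact: subr1_expRN_le.
Qed.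

Lemma pr_tau_gt i k x : (0 < i)%N -> (X0 i <= k)%N -> 0 <= x ->
  pr [set w | x < tau i k w] = expR (- (F i k * x)).
Proof.
move=> i0 ik x0; rewrite (_ : [set _ | _] = ~` [set w | tau i k w <= x]).
  rewrite pr_setC; last exact: measurable_tau_le.
  by rewrite pr_tau_le// opprB addrC subrK.
by apply/seteqP; split => w /=; rewrite ltNge => /negP.
Qed.

(** The pathwise urn lemmas assume positive sojourns, which hold only almost surely; the exceptional
    set is a countable union of null sets. *)
Lemma clocks_positive :
  P (~` [set w | forall i k, (0 < i)%N -> (X0 i <= k)%N -> 0 < tau i k w]) = 0%E.
Proof.
apply: measure_negligible.
  apply/measurableC/measurable_forall => i; apply: measurable_forall => k.
  apply: measurable_imply => _; apply: measurable_imply => _.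
  exact: measurable_tau_gt.
pose N i k := [set w | [/\ (0 < i)%N, (X0 i <= k)%N & tau i k w <= 0]].
apply: (@negligibleS _ _ _ _ (\bigcup_i \bigcup_k N i k)).
  move=> w /existsNP[i /existsNP[k /not_implyP[i0 /not_implyP[ik /negP]]]].
  by rewrite -leNgt => tau0; exists i => //; exists k.
apply: negligible_bigcup => i; apply: negligible_bigcup => k.
have [i0|i0] := boolP (0 < i)%N; last first.
  by apply: negligibleS (negligible_set0 _) => w [] /=; rewrite (negbTE i0).
have [ik|ik] := boolP (X0 i <= k)%N; last first.
  by apply: negligibleS (negligible_set0 _) => w [] /=; rewrite (negbTE ik).
have P0 : P [set w | tau i k w <= 0] = 0%E.
  rewrite -pr_fineK; last exact: measurable_tau_le.
  by rewrite pr_tau_le// mulr0 oppr0 expR0 subrr.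
by exists [set w | tau i k w <= 0]; split => // [|w []//]; exact: measurable_tau_le.
Qed.

(** * Independence of finitely many sojourns, fast starts *)

Definition cylinder (s : seq (nat * nat)) (U : nat * nat -> set R) : set T :=
  \bigcap_(j in [set` s]) (tau j.1 j.2 @^-1` U j).

Lemma measurable_cylinder s U : (forall j, measurable (U j)) ->
  measurable (cylinder s U).
Proof.
move=> mU; rewrite /cylinder bigcap_seq; apply: bigsetI_measurable => j _.
by rewrite -[_ @^-1` _]setTI; exact: measurable_tau.
Qed.

Lemma cylinder_cat s t U : cylinder (s ++ t) U = cylinder s U `&` cylinder t U.
Proof.
apply/seteqP; split => [w sw|w [sw tw] j /=].
  by split=> j js; apply: sw; rewrite /= mem_cat js ?orbT.
by rewrite mem_cat => /orP[]; [exact: sw|exact: tw].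
Qed.

Let good : set (nat * nat) := [set jk | (0 < jk.1)%N /\ (X0 jk.1 <= jk.2)%N].

Lemma pr_cylinder s U : uniq s -> (forall j, j \in s -> good j) ->
  (forall j, measurable (U j)) ->
  pr (cylinder s U) = \prod_(j <- s) pr (tau j.1 j.2 @^-1` U j).
Proof.
move=> us gs mU; apply: EFin_inj; rewrite pr_fineK ?Hind//.
  rewrite -prodEFin; apply: eq_bigr => j _; rewrite pr_fineK//.
  by rewrite -[_ @^-1` _]setTI; exact: measurable_tau.
exact: measurable_cylinder.
Qed.

Lemma pr_cylinder_cat s t U : uniq (s ++ t) ->
  (forall j, j \in s ++ t -> good j) -> (forall j, measurable (U j)) ->
  pr (cylinder s U `&` cylinder t U) = pr (cylinder s U) * pr (cylinder t U).
Proof.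
move=> ust gst mU; rewrite -cylinder_cat !pr_cylinder ?big_cat//.
- by move: ust; rewrite cat_uniq => /and3P[].
- by move=> j tj; apply: gst; rewrite mem_cat tj orbT.
- by move: ust; rewrite cat_uniq => /and3P[].
- by move=> j tj; apply: gst; rewrite mem_cat tj.
Qed.

Lemma cylinder1 i k U : cylinder [:: (i, k)] U = tau i k @^-1` U (i, k).
Proof.
apply/seteqP; split => [w /(_ (i, k))|w wU j]/=; first by rewrite inE eqxx; exact.
by rewrite inE => /eqP ->.
Qed.

Lemma pr_tau_le_indep i k j l x y : (0 < i)%N -> (X0 i <= k)%N ->
  (0 < j)%N -> (X0 j <= l)%N -> (i, k) != (j, l) ->
  pr ([set w | tau i k w <= x] `&` [set w | tau j l w <= y]) =
  pr [set w | tau i k w <= x] * pr [set w | tau j l w <= y].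
Proof.
move=> i0 ik j0 jl ne.
pose U (m : nat * nat) : set R := if m == (i, k) then `]-oo, x]%classic
  else `]-oo, y]%classic.
have -> : [set w | tau i k w <= x] = cylinder [:: (i, k)] U.
  by rewrite cylinder1 /U eqxx; apply/seteqP; split => w /=; rewrite in_itv.
have -> : [set w | tau j l w <= y] = cylinder [:: (j, l)] U.
  rewrite cylinder1 /U eq_sym (negbTE ne).
  by apply/seteqP; split => w /=; rewrite in_itv.
apply: pr_cylinder_cat => /=.
- by rewrite !inE ne.
- by move=> m; rewrite !inE => /orP[]/eqP ->.
- by move=> m; rewrite /U; case: ifP => _; exact: measurable_itv.
Qed.

(** For [K <= X0 i] this is the sure event. *)
Definition fast_start (K : nat) (eta : R) (i : nat) : set T :=
  [set w | forall k, (X0 i <= k < K)%N -> tau i k w <= eta].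

Let start_idx K i := [seq (i, k) | k <- index_iota (X0 i) K].

(** [U] is free at all other indices, so the same family can also carry a condition on a later
    sojourn. *)
Let fast_startE K eta (U : nat * nat -> set R) i :
  (forall k, (X0 i <= k < K)%N -> U (i, k) = `]-oo, eta]%classic) ->
  fast_start K eta i = cylinder (start_idx K i) U.
Proof.
move=> UE; apply/seteqP; split => w /= H.
  move=> m /= /mapP[k]; rewrite mem_index_iota => ik ->/=.
  by rewrite UE//= in_itv; exact: H.
move=> k ik; have := H (i, k); rewrite /= UE//= in_itv; apply.
by apply/mapP; exists k; rewrite ?mem_index_iota.
Qed.

Lemma measurable_fast_start K eta i : measurable (fast_start K eta i).
Proof.
rewrite (@fast_startE _ _ (fun=> `]-oo, eta]%classic))//.
by apply: measurable_cylinder => j; exact: measurable_itv.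
Qed.

Let start_idx_uniq K i : uniq (start_idx K i).
Proof. by rewrite map_inj_uniq ?iota_uniq// => k l []. Qed.

Let start_idx_good K i j : (0 < i)%N -> j \in start_idx K i -> good j.
Proof. by move=> i0 /mapP[k]; rewrite mem_index_iota => /andP[ik _] ->. Qed.

(** There are at most [K] factors, each at least [1 - expR (- (c * eta))], a number in [[0, 1]]. The
    bound depends on neither [i] nor [X0 i]. *)
Lemma pr_fast_start_ge K eta i c : (0 < i)%N -> 0 <= eta -> 0 <= c ->
  (forall k, (0 < k)%N -> c <= F i k) ->
  (1 - expR (- (c * eta))) ^+ K <= pr (fast_start K eta i).
Proof.
move=> i0 eta0 c0 cF; rewrite (@fast_startE _ _ (fun=> `]-oo, eta]%classic))//.
rewrite pr_cylinder//; last by move=> j; exact: start_idx_good.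
set q := 1 - _; have q01 : 0 <= q <= 1.
  by rewrite subr_ge0 expR_le1 oppr_le0 mulr_ge0//= lerBlDr lerDl expR_ge0.
apply: (@le_trans _ _ (\prod_(j <- start_idx K i) q)).
  rewrite big_map big_const_nat iter_mulr_1.
  by apply: ler_wiXn2l; [case/andP : q01..|exact: leq_subr].
rewrite [leLHS]big_seq [leRHS]big_seq; apply: ler_prod => j sj.
case/andP: q01 => -> _ /=; have [j0 jX] := start_idx_good i0 sj.
have -> : tau j.1 j.2 @^-1` `]-oo, eta] = [set w | tau j.1 j.2 w <= eta].
  by apply/seteqP; split => w /=; rewrite in_itv.
rewrite pr_tau_le// lerD2l lerN2 ler_expR lerN2 ler_wpM2r//.
move/mapP : sj jX j0 => [k _ ->]/= ik _.
by apply: cF; rewrite (leq_trans _ ik)// HX0.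
Qed.

Lemma pr_fast_start_indep K eta i j : (0 < i)%N -> (0 < j)%N -> i != j ->
  pr (fast_start K eta i `&` fast_start K eta j) =
  pr (fast_start K eta i) * pr (fast_start K eta j).
Proof.
move=> i0 j0 ij; rewrite !(@fast_startE _ _ (fun=> `]-oo, eta]%classic))//.
apply: pr_cylinder_cat => //.
  rewrite cat_uniq !start_idx_uniq/= andbT; apply/hasPn => _ /mapP[k _ ->].
  by apply/negP => /mapP[l _ [ji]]; move: ij; rewrite ji eqxx.
by move=> m; rewrite mem_cat => /orP[]; exact: start_idx_good.
Qed.

Lemma pr_fast_start_tail K eta i k x : (0 < i)%N -> (X0 i <= k)%N -> (K <= k)%N ->
  pr (fast_start K eta i `&` [set w | x < tau i k w]) =
  pr (fast_start K eta i) * pr [set w | x < tau i k w].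
Proof.
move=> i0 ik Kk.
(* One family serves both events: states below [K] carry the fast-start condition, the others ask
   for a value beyond [x]. *)
pose U (m : nat * nat) : set R := if (m.2 < K)%N then `]-oo, eta]%classic
  else `]x, +oo[%classic.
rewrite (@fast_startE _ _ U); last by move=> l /andP[_ lK]; rewrite /U/= lK.
have -> : [set w | x < tau i k w] = cylinder [:: (i, k)] U.
  rewrite cylinder1 /U/= ltnNge Kk.
  by apply/seteqP; split => w /=; rewrite in_itv/= andbT.
apply: pr_cylinder_cat.
- rewrite cat_uniq start_idx_uniq/= orbF andbT; apply/negP => /mapP[l].
  by rewrite mem_index_iota => /andP[_ lK] [kl]; move: lK; rewrite -kl ltnNge Kk.
- move=> j; rewrite mem_cat => /orP[|]; first exact: start_idx_good.
  by rewrite inE => /eqP ->.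
- by move=> j; rewrite /U; case: ifP => _; exact: measurable_itv.
Qed.

(** Layer-cake bound with step [h]: for [M] the integer part of [t / h], the first [M] layers are
    counted and the extra [h] covers the remainder. It turns expectations into sums of tail
    probabilities. *)
Lemma truncn_layers (h t : R) : 0 < h ->
  ((Num.max t 0)%:E <= h%:E + \sum_(n <oo) (h * (n%:R * h < t)%R%:R)%:E)%E.
Proof.
move=> h0; have u0 n : (0 <= (h * (n%:R * h < t)%R%:R)%:E :> \bar R)%E.
  by rewrite lee_fin mulr_ge0// ltW.
have [t0|t0] := leP t 0.
  by rewrite adde_ge0 ?nneseries_ge0// lee_fin ltW.
pose M := Num.truncn (t / h).
have th0 : 0 <= t / h by rewrite divr_ge0// ltW.
have /andP[Mle Mgt] := truncn_itv th0.
apply: (@le_trans _ _ (h%:E + \sum_(0 <= n < M) (h * (n%:R * h < t)%R%:R)%:E)%E).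
  rewrite sumEFin -EFinD lee_fin big_nat_cond.
  rewrite (eq_bigr (fun=> h)); last first.
    move=> n /andP[/andP[_ nM] _]; rewrite -ltr_pdivlMr//.
    by rewrite (lt_le_trans _ Mle) ?ltr_nat// mulr1.
  rewrite -big_nat_cond big_const_nat subn0 iter_addr_0.
  move: Mgt; rewrite -/M ltr_pdivrMr// -natr1 mulrDl mul1r mulr_natl addrC.
  exact: ltW.
by rewrite leeD2l// nneseries_lim_ge.
Qed.

Lemma sum_half_le (n : nat) : \sum_(0 <= k < n) (2^-1 : R) ^+ k <= 2.
Proof.
suff -> : \sum_(0 <= k < n) (2^-1 : R) ^+ k = 2 - 2 * 2^-1 ^+ n.
  by rewrite gerBl mulr_ge0// exprn_ge0// invr_ge0.
elim: n => [|n IH]; first by rewrite big_geq// expr0 mulr1 subrr.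
by rewrite big_nat_recr//= IH exprS; field.
Qed.

Lemma expRN1_le_half : expR (- 1) <= 2^-1 :> R.
Proof.
have := expRxMexpNx_1 (1 : R); have := expR_ge1Dx (1 : R).
by have := expR_gt0 (- 1 : R); nra.
Qed.

(** The later sojourn is independent of the fast start. With layers of width [1 / F i k] the [n]-th
    tail probability is [expR (- n)], at most [2^-1 ^+ n]; the geometric sum [2] and the leading
    layer give the factor [3]. *)
Lemma integral_tau_fast_start K eta i k : (0 < i)%N -> (X0 i <= k)%N ->
  (K <= k)%N ->
  (\int[P]_(w in fast_start K eta i) (Num.max (tau i k w) 0)%:E <=
   (3 * pr (fast_start K eta i) / F i k)%:E)%E.
Proof.
move=> i0 ik Kk; set D := fast_start K eta i; set h := (F i k)^-1.
have mD : measurable D by exact: measurable_fast_start.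
have h0 : 0 < h by rewrite invr_gt0 F_gt0.
pose L n := [set w | n%:R * h < tau i k w].
have mL n : measurable (L n) by exact: measurable_tau_gt.
have LE n w : (h * (n%:R * h < tau i k w)%R%:R)%:E = (h%:E * (\1_(L n) w)%:E)%E.
  rewrite -EFinM indicE; congr (_ * _)%:E; congr (_%:R); congr nat_of_bool.
  by apply/idP/idP => [nh|]; [exact/mem_set|rewrite inE].
have mLf n : measurable_fun setT (fun w => (h%:E * (\1_(L n) w)%:E)%E).
  apply: emeasurable_funM; first exact: measurable_cst.
  by apply/measurable_EFinP; exact: measurable_indic.
have Lf0 n w : (0 <= h%:E * (\1_(L n) w)%:E)%E.
  by rewrite mule_ge0// lee_fin// ltW.
apply: (@le_trans _ _ (\int[P]_(w in D)
    (h%:E + \sum_(n <oo) (h%:E * (\1_(L n) w)%:E)))%E).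
  apply: ge0_le_integral => //.
  - by move=> w _; rewrite lee_fin le_max lexx orbT.
  - apply/measurable_EFinP; apply: measurable_funTS; apply: measurable_maxr.
      exact: measurable_tau.
    exact: measurable_cst.
  - apply: emeasurable_funD; first exact: measurable_cst.
    by apply: ge0_emeasurable_sum => [n w _ _|n _]; [exact: Lf0|exact: measurable_funTS].
  - move=> w _; rewrite -(eq_eseriesr (fun n _ => LE n w)).
    exact: truncn_layers.
rewrite ge0_integralD//; last 3 first.
- by move=> w _; rewrite lee_fin ltW.
- by move=> w _; exact: nneseries_ge0.
- by apply: ge0_emeasurable_sum => [n w _ _|n _]; [exact: Lf0|exact: measurable_funTS].
rewrite integral_cst// integral_nneseries//; last first.
  by move=> n; exact: measurable_funTS.
have intL n : (\int[P]_(w in D) (h%:E * (\1_(L n) w)%:E) <=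
    (h * pr D * 2^-1 ^+ n)%:E)%E.
  rewrite ge0_integralZl//; last 2 first.
  - by apply/measurable_EFinP; exact: measurable_indic.
  - by rewrite lee_fin ltW.
  rewrite integral_indic// setIC.
  rewrite [X in (_ * X)%E](_ : _ = (pr (D `&` L n))%:E); last first.
    exact/esym/(pr_fineK P)/measurableI.
  rewrite pr_fast_start_tail// pr_tau_gt//; last by rewrite mulr_ge0// ltW.
  rewrite -EFinM lee_fin mulrA ler_wpM2l//.
    by rewrite mulr_ge0 ?pr_ge0// ltW.
  rewrite mulrCA mulrA mulrAC /h -mulrA mulVf ?mulr1; last by rewrite gt_eqF ?F_gt0.
  rewrite -[n%:R]mulr1 -mulrN expRM_natl lerXn2r ?nnegrE ?expR_ge0 ?invr_ge0//.
  exact: expRN1_le_half.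
have sumL : (\sum_(n <oo) \int[P]_(w in D) (h%:E * (\1_(L n) w)%:E) <=
    (h * pr D * 2)%:E)%E.
  apply: lime_le.
    by apply: is_cvg_nneseries => n _ _; apply: integral_ge0 => w _; exact: Lf0.
  apply: nearW => n; apply: (@le_trans _ _ (\sum_(0 <= k < n) (h * pr D * 2^-1 ^+ k)%:E)%E).
    by apply: lee_sum => m _; exact: intL.
  rewrite sumEFin lee_fin -mulr_sumr ler_wpM2l ?sum_half_le//.
  by rewrite mulr_ge0 ?pr_ge0// ltW.
rewrite [X in (_ * X + _)%E](_ : _ = (pr D)%:E); last first.
  exact/esym/(pr_fineK P).
rewrite -EFinM; apply: (le_trans (leeD2l _ sumL)); rewrite -EFinD lee_fin -/h.
by rewrite [leRHS](_ : _ = h * pr D + h * pr D * 2)//; ring.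
Qed.

(** * Total time in late states and bounds on jump times *)

Let late (K i k : nat) (w : T) : R :=
  if (K <= k)%N && (X0 i <= k)%N then Num.max (tau i k w) 0 else 0.

Let late_ge0 K i k w : 0 <= late K i k w.
Proof. by rewrite /late; case: ifP => // _; rewrite le_max lexx orbT. Qed.

(** The total time in states from [K] on may be infinite, hence the extended reals; truncation at
    [0] in [late] keeps the series monotone on every outcome. *)
Definition slow_tail (K : nat) (a : R) (i : nat) : set T :=
  [set w | (a%:E <= \sum_(k <oo) (late K i k w)%:E)%E].

Let measurable_late K i k : measurable_fun setT (fun w => (late K i k w)%:E).
Proof.
apply/measurable_EFinP; rewrite /late; case: (_ && _); last exact: measurable_cst.
by apply: measurable_maxr; [exact: measurable_tau|exact: measurable_cst].
Qed.

Let measurable_sum_late K i :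
  measurable_fun setT (fun w => (\sum_(k <oo) (late K i k w)%:E)%E).
Proof.
apply: ge0_emeasurable_sum; first by move=> k w _ _; rewrite lee_fin.
by move=> k _; exact: measurable_late.
Qed.

Lemma measurable_slow_tail K a i : measurable (slow_tail K a i).
Proof.
rewrite /slow_tail -[X in measurable X]setTI.
by apply: emeasurable_fun_c_infty => //; exact: measurable_sum_late.
Qed.

(** Markov's inequality on the fast start: the late time integrates over it to at most [3 * delta]
    times its probability. *)
Lemma pr_fast_start_slow_tail K eta a delta i : (0 < i)%N -> (0 < K)%N -> 0 < a ->
  (forall n, \sum_(K <= k < n) (F i k)^-1 <= delta) ->
  pr (fast_start K eta i `&` slow_tail K a i) <= 3 * delta / a * pr (fast_start K eta i).
Proof.
move=> i0 K0 a0 Fdelta; set D := fast_start K eta i.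
have mD : measurable D by exact: measurable_fast_start.
have mS := measurable_slow_tail K a i.
have late_int k : (\int[P]_(w in D) (late K i k w)%:E <=
    (3 * pr D * (if (K <= k)%N then (F i k)^-1 else 0))%:E)%E.
  rewrite /late; case: (boolP ((K <= k)%N && (X0 i <= k)%N)) => [/andP[Kk ik]|_].
    by rewrite Kk; exact: integral_tau_fast_start.
  rewrite integral0 lee_fin !mulr_ge0 ?pr_ge0//.
  case: ifP => // Kk; rewrite invr_ge0 ltW// HF//.
  exact: leq_trans Kk.
have M : (a%:E * P (D `&` slow_tail K a i) <= (3 * pr D * delta)%:E)%E.
  apply: le_trans (markov_set P mD (measurable_sum_late K i) _ a0) _.
    by move=> w; apply: nneseries_ge0 => k _ _; rewrite lee_fin.
  rewrite integral_nneseries//; last 2 first.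
  - by move=> k; exact/measurable_funTS/measurable_late.
  - by move=> k w _; rewrite lee_fin.
  apply: lime_le.
    apply: is_cvg_nneseries => n _ _.
    by apply: integral_ge0 => w _; rewrite lee_fin.
  apply: nearW => n; apply: (le_trans (lee_sum _ (fun k _ => late_int k))).
  rewrite sumEFin lee_fin -mulr_sumr ler_wpM2l// ?mulr_ge0 ?pr_ge0//.
  rewrite -big_mkcond/= (le_trans _ (Fdelta n))//.
  have [nK|Kn] := leqP n K.
    rewrite big_nat_cond big_pred0 ?big_geq// => k.
    by apply/negP => /andP[/andP[_ kn] /leq_ltn_trans/(_ kn)]; rewrite ltnNge nK.
  by rewrite (big_nat_widenl K 0)//.
rewrite mulrAC ler_pdivlMr// mulrC -lee_fin EFinM mulrAC.
by rewrite pr_fineK//; exact: measurableI.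
Qed.

Lemma jump_time_le K eta a i k w : 0 <= eta -> (X0 i <= k)%N ->
  fast_start K eta i w -> ~ slow_tail K a i w ->
  jump_time (X0 i) (fun l => tau i l w) k <= K%:R * eta + a.
Proof.
move=> eta0 ik fw /negP; rewrite -ltNge => sw.
(* [minn K n] bounds the number of fast sojourns before state [n]; sojourns from [K] on are charged
   to [late]. *)
have H n : \sum_(X0 i <= l < n) tau i l w <=
    (minn K n)%:R * eta + \sum_(0 <= l < n) late K i l w.
  elim: n => [|n IH].
    by rewrite !big_geq// addr0 mulr_ge0.
  have [iltn|] := ltnP n (X0 i).
    by rewrite big_geq// addr_ge0 ?mulr_ge0 ?sumr_ge0.
  move=> iln; rewrite !big_nat_recr//= addrA.
  have [nK|Kn] := ltnP n K.
    have -> : (minn K n.+1)%:R = (minn K n)%:R + 1 :> R.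
      by rewrite (minn_idPr nK) (minn_idPr (ltnW nK)) -natr1.
    rewrite mulrDl mul1r.
    have : tau i n w <= eta by apply: fw; rewrite iln.
    by have := late_ge0 K i n w; move: IH; lra.
  rewrite (minn_idPl (leqW Kn)); move: IH; rewrite (minn_idPl Kn) => IH.
  rewrite lerD// /late Kn iln/= le_max lexx//.
apply: (le_trans (H k.+1)); apply: lerD.
  by rewrite ler_wpM2r// ler_nat geq_minl.
rewrite -lee_fin -sumEFin; apply: ltW; apply: le_lt_trans sw.
by apply: nneseries_lim_ge => n _ _; rewrite lee_fin.
Qed.

(** Explosion is stated as a bound on all jump times, the form in which [urn_limit_stuck] uses
    it. *)
Definition early_explosion (A : nat) (eps : R) : set T :=
  [set w | exists j, (1 <= j <= A)%N /\ forall k, (X0 j <= k)%N ->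
    jump_time (X0 j) (fun l => tau j l w) k <= eps].

Lemma measurable_early_explosion A eps : measurable (early_explosion A eps).
Proof.
apply: measurable_exists => j.
rewrite (_ : [set _ | _] = [set w | (1 <= j <= A)%N] `&` [set w | forall k,
    (X0 j <= k)%N -> jump_time (X0 j) (fun l => tau j l w) k <= eps]); last first.
  by apply/seteqP; split.
apply: measurableI; first exact: measurable_prop.
apply: measurable_forall => k; apply: measurable_imply => _.
apply: measurable_set_le; last exact: measurable_cst.
exact: (measurable_jump_time X0 (fun i l => measurable_tau i l) j k).
Qed.

(** * Moved agents, up to the null set of nonpositive sojourns *)

Let nonpos : set T :=
  ~` [set w | forall i k, (0 < i)%N -> (X0 i <= k)%N -> 0 < tau i k w].

Let measurable_nonpos : measurable nonpos.
Proof.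
apply/measurableC/measurable_forall => i; apply: measurable_forall => k.
apply: measurable_imply => _; apply: measurable_imply => _.
exact: measurable_tau_gt.
Qed.

Let pr_nonposU (E : set T) : measurable E -> pr (nonpos `|` E) <= pr E.
Proof.
move=> mE; rewrite (le_trans (pr_setU_le P measurable_nonpos mE))//.
by rewrite clocks_positive add0r.
Qed.

Definition moved (A i : nat) : set T :=
  [set w | urn_limit X0 (clocks w) A i != Some (X0 i)].

Lemma movedC A i :
  ~` moved A i = [set w | urn_limit X0 (clocks w) A i = Some (X0 i)].
Proof.
apply/seteqP; split => w /=; first by move/negP/negPn/eqP.
by move=> /eqP ?; apply/negP; rewrite negbK.
Qed.

Lemma measurable_moved A i : measurable (moved A i).
Proof.
rewrite -[moved A i]setCK movedC; apply: measurableC.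
exact: (measurable_urn_limit X0 A (fun i k => measurable_tau i k)).
Qed.

Lemma n_movedE A w :
  (n_moved X0 (clocks w) A)%:R = \sum_(i <- index_iota 1 A.+1) \1_(moved A i) w :> R.
Proof.
rewrite /n_moved natr_sum; apply: eq_bigr => i _; rewrite indicE; congr (_%:R).
by congr nat_of_bool; apply/idP/idP => [?|]; [exact/mem_set|rewrite inE].
Qed.

Lemma n_stuck_moved A w :
  (n_stuck X0 (clocks w) A + n_moved X0 (clocks w) A)%N = A.
Proof.
rewrite /n_stuck /n_moved -big_split/= (eq_bigr (fun=> 1%N)) => [|i _].
  by rewrite sum_nat_const_nat subSS subn0 muln1.
by case: eqP.
Qed.

(** Off the null set, [i] is stuck if its first sojourn exceeds [eps] and some agent has exploded by
    [eps]. *)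
Lemma pr_moved_le A i eps : (1 <= i <= A)%N -> 0 <= eps ->
  pr (moved A i) <= F i (X0 i) * eps + pr (~` early_explosion A eps).
Proof.
move=> iA eps0; have i0 : (0 < i)%N by case/andP : iA.
have mE := measurableC (measurable_early_explosion A eps).
have mt := measurable_tau_le i (X0 i) eps.
apply: (@le_trans _ _ (pr (nonpos `|`
    ([set w | tau i (X0 i) w <= eps] `|` ~` early_explosion A eps)))).
  apply: pr_le; first exact: measurable_moved.
    by apply: measurableU => //; exact: measurableU.
  move=> w /=; apply: contraPP => /not_orP[/contrapT pos /not_orP[/negP ti]].
  move=> /contrapT[j [jA jeps]] /negP; apply; apply/eqP.
  apply: (urn_limit_stuck _ iA jA jeps); last by rewrite ltW// ltNge.
  by move=> k l /andP[k0 _]; exact: pos.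
apply: le_trans (pr_nonposU (measurableU _ _ mt mE)) _.
apply: le_trans (pr_setU_le P mt mE) _; rewrite lerD2r.
by rewrite pr_tau_le//; exact: subr1_expRN_le.
Qed.

(** * Explosive agents, early explosions and stuck agents *)

Section Explosive.
Variable B : set nat.
Hypothesis HBpos : B `<=` [set i | (0 < i)%N].
Hypothesis HBinf : infinite_set B.
Hypothesis Hsum :
  (\sum_(1 <= k <oo) ereal_sup [set ((F i k)^-1)%:E | i in B] < +oo)%E.

Let a k : \bar R := ereal_sup [set ((F i k)^-1)%:E | i in B].

Let inv_le_sup i k : B i -> (((F i k)^-1)%:E <= a k)%E.
Proof. by move=> Bi; apply: ereal_sup_ubound; exists i. Qed.

Let sup_ge0 k : (0 < k)%N -> (0 <= a k)%E.
Proof.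
have [i Bi] := infinite_setN0 HBinf.
move=> k0; rewrite (le_trans _ (inv_le_sup k Bi))// lee_fin invr_ge0 ltW//.
by apply: HF => //; exact: HBpos.
Qed.

Let partial_le n : (\sum_(1 <= k < n) a k <= \sum_(1 <= k <oo) a k)%E.
Proof. by apply: nneseries_lim_ge => k k0 _; exact: sup_ge0. Qed.

Let total_fin : exists q : R, (\sum_(1 <= k <oo) a k)%E = q%:E.
Proof.
exists (fine (\sum_(1 <= k <oo) a k)%E); rewrite fineK// ge0_fin_numE//.
by apply: nneseries_ge0 => k k0 _; exact: sup_ge0.
Qed.

(** Each term of the convergent series is at most its sum [q], which bounds all inverse rates on
    [B]; [q + 1] avoids inverting zero. *)
Lemma rate_lower_bound :
  exists2 c, 0 < c & forall i k, B i -> (0 < k)%N -> c <= F i k.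
Proof.
have [q qE] := total_fin.
have q0 : 0 <= q by rewrite -lee_fin -qE nneseries_ge0// => k k0 _; exact: sup_ge0.
have q1 : 0 < q + 1 by lra.
exists (q + 1)^-1; first by rewrite invr_gt0.
move=> i k Bi k0; have Fik : 0 < F i k by apply: HF => //; exact: HBpos.
rewrite -[leRHS]invrK lef_pV2 ?posrE ?invr_gt0//.
apply: (@le_trans _ _ q); last by rewrite lerDl.
rewrite -lee_fin -qE (le_trans (inv_le_sup k Bi))// (le_trans _ (partial_le k.+1))//.
rewrite big_nat_recr//= leeDr// big_nat_cond sume_ge0// => l /andP[/andP[l0 _] _].
exact: sup_ge0.
Qed.

(** The supremum stands inside the series, so one tail dominates those of all agents of [B] and [K]
    is common to them. *)
Lemma inv_rate_tail (delta : R) : 0 < delta -> exists2 K, (0 < K)%N &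
  forall i n, B i -> \sum_(K <= k < n) (F i k)^-1 <= delta.
Proof.
move=> delta0; have [q qE] := total_fin.
have : (\sum_(1 <= k < n) a k)%E @[n --> \oo] --> q%:E.
  by rewrite -qE; apply: is_cvg_nneseries => k k0 _; exact: sup_ge0.
move=> /fine_cvgP[finS /cvgrPdist_lt/(_ _ delta0) close].
have [K [K0 [finK closeK]]] : exists K, (0 < K)%N /\
    ((\sum_(1 <= k < K) a k)%E \is a fin_num /\
     `|q - fine (\sum_(1 <= k < K) a k)%E| < delta).
  have [N _ H] : \forall n \near \oo, (\sum_(1 <= k < n) a k)%E \is a fin_num /\
     `|q - fine (\sum_(1 <= k < n) a k)%E| < delta by near=> n; split; near: n.
  exists N.+1; split => //; exact: H (leqnSn N).
exists K => // i n Bi; have [nK|Kn] := leqP n K.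
  by rewrite big_geq// ltW.
rewrite (@le_trans _ _ (q - fine (\sum_(1 <= k < K) a k)%E))//; last first.
  by rewrite (le_trans (ler_norm _))// ltW.
rewrite lerBrDr -lee_fin EFinD fineK// -qE (le_trans _ (partial_le n))//.
rewrite (big_cat_nat K0 (ltnW Kn))/= addeC leeD2l// -sumEFin.
by apply: lee_sum => k _; exact: inv_le_sup.
Unshelve. all: by end_near. Qed.

Lemma early_explosion_likely (eps gam : R) : 0 < eps -> 0 < gam ->
  exists A0, forall A, (A0 <= A)%N -> pr (~` early_explosion A eps) <= gam.
Proof.
move=> eps0 gam0; have [c c0 cF] := rate_lower_bound.
(* With [a = eps / 2] and this [delta], the factor [3 * delta / a] is [gam / 4], and Markov's
   inequality at [mu / 2] then gives [gam / 2]. *)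
have delta0 : 0 < gam * eps / 24 by rewrite divr_gt0// mulr_gt0.
have [K K0 tailK] := inv_rate_tail delta0.
pose eta := eps / (2 * K%:R); pose q := (1 - expR (- (c * eta))) ^+ K.
have KR : 0 < K%:R :> R by rewrite ltr0n.
have eta0 : 0 < eta by rewrite divr_gt0// mulr_gt0.
have q0 : 0 < q.
  by rewrite exprn_gt0// subr_gt0 expR_lt1 oppr_lt0 mulr_gt0.
(* With [m] agents the mean [mu] of fast starts exceeds [8 / gam], so Chebyshev's bound at half the
   mean, [4 / mu], is at most [gam / 2]. *)
pose m := (Num.truncn (8 / (gam * q))).+1.
have [s sB ms] := infinite_set_fset m HBinf.
pose A0 := \max_(i <- finmap.enum_fset s) i.
exists A0 => A A0A.
pose r := finmap.enum_fset s.
have rB i : i \in r -> B i by move=> ri; apply: sB.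
have r0 i : i \in r -> (0 < i)%N by move=> /rB/HBpos.
have rA i : i \in r -> (1 <= i <= A)%N.
  move=> ri; rewrite r0//= (leq_trans _ A0A)//.
  exact: (@leq_bigmax_seq _ r xpredT id).
have ur : uniq r by exact: finmap.fset_uniq.
pose H i := fast_start K eta i; pose S i := H i `&` slow_tail K (eps / 2) i.
have mH i : measurable (H i) by exact: measurable_fast_start.
have mS i : measurable (S i) by apply: measurableI => //; exact: measurable_slow_tail.
pose mu := \sum_(i <- r) pr (H i).
have muge : 8 / gam < mu.
  apply: (@lt_le_trans _ _ (m%:R * q)).
    rewrite -ltr_pdivrMr// -mulrA -invfM /m.
    have /truncn_itv/andP[_] : 0 <= 8 / (gam * q) by rewrite divr_ge0// mulr_ge0// ltW.
    by [].
  apply: (@le_trans _ _ ((size r)%:R * q)).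
    by rewrite ler_wpM2r ?ler_nat// ltW.
  rewrite -sum1_size natr_sum mulr_suml /mu big_seq [leRHS]big_seq.
  apply: ler_sum => i ri; rewrite mul1r.
  by apply: pr_fast_start_ge; rewrite ?r0 ?ltW// => k; exact/cF/rB.
have mu0 : 0 < mu by rewrite (lt_trans _ muge)// divr_gt0.
have few : pr [set w | \sum_(i <- r) \1_(H i) w < mu / 2] <= gam / 2.
  apply: (le_trans (@chebyshev_count _ _ _ P _ r H (mu / 2) ur mH _ _)).
  - by move=> i j /r0 i0 /r0 j0; exact: pr_fast_start_indep.
  - by rewrite -/mu; lra.
  - rewrite -/mu ler_pdivrMr ?exprn_gt0//; last by lra.
    move: muge; rewrite ltr_pdivrMr// => muge.
    by rewrite (_ : _ * _ = (mu * gam / 8) * mu); [nra|field].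
have many : pr [set w | mu / 2 <= \sum_(i <- r) \1_(S i) w] <= gam / 2.
  apply: (le_trans (@markov_count _ _ _ P _ r S (mu / 2) mS _)); first by lra.
  rewrite ler_pdivrMr; last by lra.
  apply: (@le_trans _ _ (\sum_(i <- r) gam / 4 * pr (H i))).
    rewrite big_seq [leRHS]big_seq; apply: ler_sum => i ri.
    have := @pr_fast_start_slow_tail K eta (eps / 2) (gam * eps / 24) i (r0 i ri) K0 _ _.
    rewrite (_ : 3 * _ / _ = gam / 4); last by field; rewrite gt_eqF.
    by apply; [lra|move=> n; exact/tailK/rB].
  by rewrite -mulr_sumr -/mu; lra.
have mfew : measurable [set w | \sum_(i <- r) \1_(H i) w < mu / 2].
  by apply: measurable_set_lt; [exact: measurable_count|exact: measurable_cst].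
have mmany : measurable [set w | mu / 2 <= \sum_(i <- r) \1_(S i) w].
  by apply: measurable_set_le; [exact: measurable_cst|exact: measurable_count].
rewrite (le_trans (pr_le P _ (measurableU _ _ mfew mmany) _))//.
- exact/measurableC/measurable_early_explosion.
- move=> w; apply: contra_notP => /not_orP[/= /negP + /negP].
  rewrite -leNgt -ltNge => Hw Sw.
  (* There are more fast starts than fast starts with a slow tail, so some agent has a fast start
     only; its jump times are at most [K * eta + eps / 2 = eps]. *)
  have [i ri] : exists2 i, i \in r & \1_(S i) w < \1_(H i) w :> R.
    apply/not_exists2P => nlt; have := lt_le_trans Sw Hw.
    rewrite ltNge [leLHS]big_seq [leRHS]big_seq => /negP; apply.
    by apply: ler_sum => i ri; rewrite leNgt; apply/negP; have [] := nlt i.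
  rewrite !indicE; case: (boolP (w \in H i)) => [/set_mem wH|_]; last first.
    by rewrite ltNge ler0n.
  case: (boolP (w \in S i)) => [|/negP wS _]; first by rewrite ltxx.
  exists i; split; first exact: rA.
  move=> k ik; have nS : ~ slow_tail K (eps / 2) i w.
    by move=> sw; apply: wS; apply/mem_set; split.
  rewrite (le_trans (jump_time_le (ltW eta0) ik wH nS))//.
  rewrite le_eqVlt; apply/orP; left; apply/eqP; rewrite /eta; field.
  by rewrite gt_eqF.
- by rewrite (le_trans (pr_setU_le P mfew mmany))//; lra.
Qed.

Let early eps gam (eps0 : 0 < eps) (gam0 : 0 < gam) :=
  early_explosion_likely eps0 gam0.

Lemma agent_stuck i : (0 < i)%N ->
  (fun A => P [set w | urn_limit X0 (clocks w) A i = Some (X0 i)])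
    @ \oo --> 1%E.
Proof.
move=> i0; under eq_fun do rewrite -movedC.
apply: cvg_pr1 => [A|gam gam0]; first exact/measurableC/measurable_moved.
have F0 : 0 < F i (X0 i) by apply: HF => //; exact: HX0.
have eps0 : 0 < gam / (2 * F i (X0 i)) by rewrite divr_gt0// mulr_gt0.
have gam20 : 0 < gam / 2 by lra.
have [A0 HA] := early eps0 gam20.
exists (maxn A0 i) => A; rewrite geq_max => /andP[A0A iA]; rewrite setCK.
apply: (le_trans (pr_moved_le _ (ltW eps0))); first by rewrite i0.
rewrite (_ : F i (X0 i) * _ = gam / 2); last by field; rewrite gt_eqF.
by have := HA A A0A; lra.
Qed.

Lemma stuck_fraction (M : R) (N : nat) : 0 < M ->
  (forall i, (N <= i)%N -> F i (X0 i) <= M) -> forall x : R, x < 1 ->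
  (fun A => P [set w | (n_stuck X0 (clocks w) A)%:R / A%:R <= x])
    @ \oo --> 0%E.
Proof.
move=> M0 FM x x1.
have mstuck A : measurable [set w | (n_stuck X0 (clocks w) A)%:R / A%:R <= x].
  rewrite (_ : [set _ | _] = [set w |
      (A%:R - \sum_(i <- index_iota 1 A.+1) \1_(moved A i) w) / A%:R <= x]).
    apply: measurable_set_le; last exact: measurable_cst.
    apply: measurable_funM; last exact: measurable_cst.
    apply: measurable_funB; first exact: measurable_cst.
    by apply: measurable_count => i; exact: measurable_moved.
  by apply/seteqP; split => w /=;
    rewrite -n_movedE -[X in X%:R - _](n_stuck_moved A w) natrD addrK.
apply: cvg_pr0 => // gam gam0.
(* The mean number of moved agents is at most [g * A], in three thirds: agents below [N], early
   first jumps, and a missing early explosion. Markov's inequality at [(1 - x) * A] then gives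
   [gam]. *)
pose g := gam * (1 - x); have g0 : 0 < g by rewrite mulr_gt0// subr_gt0.
have eps0 : 0 < g / (3 * M) by rewrite divr_gt0// mulr_gt0.
have g30 : 0 < g / 3 by rewrite divr_gt0.
have [A0 HA] := early eps0 g30.
pose A1 := (Num.truncn (3 * N%:R / g)).+1.
exists (maxn A0 A1) => A; rewrite geq_max => /andP[A0A A1A].
have Ng0 : 0 <= 3 * N%:R / g by apply: divr_ge0; [rewrite mulr_ge0|exact: ltW].
have AR : 3 * N%:R / g < A%:R.
  have /truncn_itv/andP[_ +] := Ng0.
  by move=> /lt_le_trans; apply; rewrite ler_nat.
have A0' : 0 < A%:R :> R by rewrite (le_lt_trans _ AR).
have mM i : measurable (moved A i) by exact: measurable_moved.
apply: (@le_trans _ _ (pr [set w | (1 - x) * A%:R <=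
    \sum_(i <- index_iota 1 A.+1) \1_(moved A i) w])).
  apply: pr_le => //.
    by apply: measurable_set_le; [exact: measurable_cst|exact: measurable_count].
  move=> w /=; rewrite -n_movedE ler_pdivrMr// => Hx.
  have : (n_stuck X0 (clocks w) A)%:R + (n_moved X0 (clocks w) A)%:R = A%:R :> R.
    by rewrite -natrD n_stuck_moved.
  by rewrite mulrBl mul1r; lra.
have xA0 : 0 < (1 - x) * A%:R by rewrite mulr_gt0// subr_gt0.
apply: (le_trans (markov_count P _ mM xA0)); rewrite ler_pdivrMr//.
rewrite mulrA -/g.
apply: (@le_trans _ _ (\sum_(i <- index_iota 1 A.+1)
    ((i < N)%N%:R + (2 * g / 3)))).
  rewrite [leLHS]big_nat_cond [leRHS]big_nat_cond.
  apply: ler_sum => i /andP[/andP[i0 iA] _].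
  have [iN|Ni] := ltnP i N; first by rewrite (le_trans (pr_le1 P (mM i)))// lerDl; lra.
  apply: (le_trans (pr_moved_le _ (ltW eps0))); first by rewrite i0.
  rewrite add0r; have := HA A A0A.
  suff : F i (X0 i) * (g / (3 * M)) <= g / 3 by lra.
  rewrite (_ : g / (3 * M) = g / 3 / M); last by field; rewrite gt_eqF.
  by rewrite mulrA ler_pdivrMr// mulrC ler_wpM2l ?(ltW g30)// FM.
rewrite big_split/= -natr_sum big_const_nat iter_addr_0 subSS subn0 -mulr_natl.
have : (\sum_(1 <= i < A.+1) (i < N))%:R <= N%:R :> R.
  by rewrite ler_nat (leq_trans (sum_ltn_le N A))// geq_minl.
by move: AR; rewrite ltr_pdivrMr//; lra.
Qed.

End Explosive.

(** * Unboundedly many moved agents *)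

Lemma many_moved (c : R) (N K : nat) : 0 < c ->
  (forall i, (N <= i)%N -> c <= F i (X0 i)) ->
  (fun i => F i (X0 i).+1 / i%:R) @ \oo --> 0 ->
  (fun A => P [set w | (K <= n_moved X0 (clocks w) A)%N]) @ \oo --> 1%E.
Proof.
move=> c0 cF F0.
have KE A : [set w | (K <= n_moved X0 (clocks w) A)%N] =
    [set w | K%:R <= \sum_(i <- index_iota 1 A.+1) \1_(moved A i) w :> R].
  by apply/seteqP; split => w /=; rewrite -n_movedE ler_nat.
have mK A : measurable [set w | (K <= n_moved X0 (clocks w) A)%N].
  rewrite KE; apply: measurable_set_le; first exact: measurable_cst.
  by apply: measurable_count => i; exact: measurable_moved.
apply: cvg_pr1 => // gam gam0.
(* [L - K >= L / 2] bounds Chebyshev's error by [4 / L], and [L >= 8 / gam] makes this at most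
   [gam / 2]. *)
pose L : R := 2 * K%:R + 8 / gam.
have g8 : 0 < 8 / gam by rewrite divr_gt0.
have L0 : 0 < L by rewrite ltr_wpDl// mulr_ge0.
(* As [e <= 4 * L / (c * A)], a second sojourn of rate at most [delta * A] ends within [e] with
   probability at most [4 * L * delta / c = gam / (2 * L)]; weighted by first jumps of total mean
   [L] this gives [gam / 2]. *)
pose delta := gam * c / (8 * L ^+ 2).
have delta0 : 0 < delta by rewrite divr_gt0 ?mulr_gt0// exprn_gt0.
have [N1 HN1] : exists N1, forall i, (N1 <= i)%N ->
    F i (X0 i).+1 <= delta * i%:R.
  (* The successor excludes [i = 0], where the quotient has a junk value. *)
  move/cvgrPdist_le : F0 => /(_ _ delta0)[N1 _ HN1]; exists N1.+1 => i Ni.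
  have iR : 0 < i%:R :> R by rewrite ltr0n; exact: leq_trans Ni.
  have := HN1 i (ltnW Ni); rewrite /= sub0r normrN => /(le_trans (ler_norm _)).
  by rewrite ler_pdivrMr.
(* The finitely many agents below [N1] escape the limit bound; [Mx] bounds their rates and is at
   most [delta * A] for large [A]. *)
pose Mx : R := \sum_(1 <= i < N1) F i (X0 i).+1.
pose A1 := (Num.truncn (`|4 * L| + `|Mx / delta|)).+1.
exists (maxn (2 * N) A1) => A; rewrite geq_max => /andP[NA A1A].
have AR : `|4 * L| + `|Mx / delta| < A%:R.
  have /truncn_itv/andP[_ +] : 0 <= `|4 * L| + `|Mx / delta| by rewrite addr_ge0.
  by move=> /lt_le_trans; apply; rewrite ler_nat.
have LA : 4 * L <= A%:R.
  by have := ler_norm (4 * L); have := normr_ge0 (Mx / delta); lra.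
have A0 : 0 < A%:R :> R by rewrite (lt_le_trans _ LA)// mulr_gt0.
have MA : Mx <= delta * A%:R.
  rewrite mulrC -ler_pdivrMr//.
  by have := ler_norm (Mx / delta); have := normr_ge0 (4 * L); lra.
have Fi0 i : (0 < i)%N -> 0 < F i (X0 i) by move=> i0; apply: HF => //; exact: HX0.
have FS0 i : (0 < i)%N -> 0 < F i (X0 i).+1 by move=> i0; exact: HF.
have FA i : (0 < i <= A)%N -> F i (X0 i).+1 <= delta * A%:R.
  move=> /andP[i0 iA]; have [Ni|iN] := leqP N1 i.
    by rewrite (le_trans (HN1 i Ni))// ler_wpM2l ?ler_nat// ltW.
  rewrite (le_trans _ MA)// /Mx (bigD1_seq i)/= ?iota_uniq ?mem_index_iota ?i0//.
  by rewrite lerDl big_nat_cond sumr_ge0// => j /andP[/andP[j0 _] _]; rewrite ltW// FS0.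
have [e [e0 em eL]] := sum_subr1_expRN_attains c0 L0 Fi0 cF NA LA.
pose H i := [set w | tau i (X0 i) w <= e].
(* When sojourns are positive, [D i] contains every double jump by time [e], and it is an
   intersection of two independent events. *)
pose D i := H i `&` [set w | tau i (X0 i).+1 w <= e].
have mH i : measurable (H i) by exact: measurable_tau_le.
have mD i : measurable (D i) by apply: measurableI => //; exact: measurable_tau_le.
pose r := index_iota 1 A.+1.
have r0 i : i \in r -> (0 < i)%N by rewrite mem_index_iota => /andP[].
have rA i : i \in r -> (0 < i <= A)%N by rewrite mem_index_iota ltnS.
have muL : \sum_(i <- r) pr (H i) = L.
  rewrite -eL /r [LHS]big_seq [RHS]big_seq; apply: eq_bigr => i /r0 i0.
  by rewrite pr_tau_le.
have few : pr [set w | \sum_(i <- r) \1_(H i) w < K%:R :> R] <= gam / 2.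
  apply: (le_trans (@chebyshev_count _ _ _ P _ r H K%:R _ mH _ _)).
  - exact: iota_uniq.
  - move=> i j /r0 i0 /r0 j0 ij; apply: pr_tau_le_indep => //.
    by apply: contra ij => /eqP[->].
  - by rewrite muL /L; have : 0 <= K%:R :> R by []; lra.
  - rewrite muL; have LK : L / 2 <= L - K%:R.
      by rewrite /L; have : 0 <= K%:R :> R by []; lra.
    rewrite ler_pdivrMr; last by rewrite exprn_gt0//; lra.
    apply: (@le_trans _ _ (gam / 2 * (L / 2) ^+ 2)); last first.
      by rewrite ler_wpM2l ?ler_pXn2r ?nnegrE//; lra.
    have : 8 <= L * gam by rewrite -ler_pdivrMr// /L lerDr mulr_ge0.
    by rewrite (_ : gam / 2 * _ = (L * gam / 8) * L); [nra|field].
have twice : pr [set w | 1 <= \sum_(i <- r) \1_(D i) w :> R] <= gam / 2.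
  apply: (le_trans (@markov_count _ _ _ P _ r D 1 mD _)) => //; rewrite divr1.
  apply: (@le_trans _ _ (\sum_(i <- r) pr (H i) * (gam / (2 * L)))).
    rewrite [leLHS]big_seq [leRHS]big_seq; apply: ler_sum => i ri.
    rewrite /D pr_tau_le_indep ?r0 ?leqnSn//; last first.
      by apply/eqP => -[]; exact: n_Sn.
    rewrite ler_wpM2l ?pr_ge0// pr_tau_le ?r0 ?leqnSn//.
    apply: (le_trans (subr1_expRN_le _)).
    apply: (@le_trans _ _ (delta * A%:R * (4 * L / (c * A%:R)))).
      by apply: ler_pM => //; [rewrite ltW// FS0 ?r0|exact/FA/rA].
    rewrite le_eqVlt; apply/orP; left; apply/eqP; rewrite /delta; field.
    by rewrite !gt_eqF.
  rewrite -mulr_suml muL le_eqVlt; apply/orP; left; apply/eqP; field.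
  by rewrite gt_eqF.
have mfew : measurable [set w | \sum_(i <- r) \1_(H i) w < K%:R :> R].
  by apply: measurable_set_lt; [exact: measurable_count|exact: measurable_cst].
have mtwice : measurable [set w | 1 <= \sum_(i <- r) \1_(D i) w :> R].
  by apply: measurable_set_le; [exact: measurable_cst|exact: measurable_count].
have mU := measurableU _ _ mfew mtwice.
apply: (@le_trans _ _ (pr (nonpos `|` (_ `|` _)))); last first.
  apply: (le_trans (pr_nonposU mU)); apply: (le_trans (pr_setU_le P mfew mtwice)).
  by lra.
apply: pr_le; [exact: measurableC|exact: measurableU|].
rewrite KE => w; apply: contra_notP => /not_orP[/contrapT pos].
move=> /not_orP[/= /negP + /negP]; rewrite -leNgt -ltNge => Hw Dw.
have nD i : i \in r -> ~ D i w.
  move=> ri Di; move: Dw; rewrite (bigD1_seq i)/= ?iota_uniq//.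
  rewrite indicE mem_set//= ltNge lerDl => /negP; apply.
  by apply: sumr_ge0.
(* Termwise comparison: as nobody jumps twice by [e], every agent with an early first jump is
   moved. *)
apply: (le_trans Hw); rewrite [leLHS]big_seq [leRHS]big_seq.
apply: ler_sum => i ri; rewrite !indicE ler_nat.
case: (boolP (w \in H i)) => [/set_mem Hi|_//].
suff wM : moved A i w by rewrite mem_set.
apply: (@urn_limit_moved _ X0 (clocks w) A _ i e) => //.
- by move=> j k /andP[j0 _]; exact: pos.
- exact: rA.
- move=> j jA; have j0 : (0 < j)%N by case/andP : jA.
  rewrite jump_timeS// jump_time_start.
  have := pos j (X0 j) j0 (leqnn _); have := pos j (X0 j).+1 j0 (leqnSn _).
  have rj : j \in r by rewrite mem_index_iota ltnS.
  have [le1|] := leP (tau j (X0 j) w) e; last by lra.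
  have [le2|] := leP (tau j (X0 j).+1 w) e; last by lra.
  by have := nD j rj (conj le1 le2).
Qed.

End Model.

Theorem theorem5 (d : measure_display) (T : measurableType d) (R : realType)
  (P : probability T R)
  (F : nat -> nat -> R) (X0 : nat -> nat)
  (tau : nat -> nat -> {RV P >-> R}) (B : set nat)
  (HF : forall i k, (0 < i)%N -> (0 < k)%N -> 0 < F i k)
  (HX0 : forall i, (0 < i)%N -> (0 < X0 i)%N)
  (Hexp : forall i k, (0 < i)%N -> (X0 i <= k)%N ->
     forall U : set R, measurable U ->
       distribution P (tau i k) U = exponential_prob (F i k) U)
  (Hind : mutually_independent P
     [set jk : nat * nat | (0 < jk.1)%N /\ (X0 jk.1 <= jk.2)%N]
     (fun jk => tau jk.1 jk.2))
  (HBpos : B `<=` [set i | (0 < i)%N])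
  (HBinf : infinite_set B)
  (Hsum : (\sum_(1 <= k <oo) ereal_sup [set ((F i k)^-1)%:E | i in B] < +oo)%E) :
  [/\
   (* 1. *)
   (fun A : nat =>
      P [set w | urn_limit X0 (fun i k => tau i k w) A 1 = Some (X0 1%N)])
     @ \oo --> 1%E,
   (* 2. *)
   (limn_esup (fun i => (F i (X0 i))%:E) < +oo)%E ->
     forall x : R, x != 1 ->
       (fun A : nat =>
          P [set w | ((n_stuck X0 (fun i k => tau i k w) A)%:R / A%:R <= x)%R])
         @ \oo --> (if (1 <= x)%R then 1%E else 0%E)
   &
   (* 3. *)
   (0 < limn_einf (fun i => (F i (X0 i))%:E))%E ->
   (fun i : nat => F i (X0 i).+1 / i%:R) @ \oo --> 0 ->
     forall K : nat,
       (fun A : nat =>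
          P [set w | (K <= n_moved X0 (fun i k => tau i k w) A)%N])
         @ \oo --> 1%E].
Proof.
split.
- exact: (agent_stuck HF HX0 Hexp Hind HBpos HBinf Hsum (isT : (0 < 1)%N)).
- move=> /eventually_le_of_limn_esup[M [N [M0 FM]]] x x1; case: leP => [x_ge1|x_lt1].
    (* For [x >= 1] the event is sure: the fraction never exceeds [1], and for [A = 0] it is [0]
       since [0^-1 = 0]. *)
    rewrite (_ : (fun A => _) = cst 1%E); first exact: cvg_cst.
    apply/funext => A; rewrite (_ : [set _ | _] = setT); first exact: probability_setT.
    apply/seteqP; split => // w _ /=; apply: le_trans x_ge1.
    have [->|A0] := posnP A; first by rewrite invr0 mulr0 ler01.
    by rewrite ler_pdivrMr ?ltr0n// mul1r ler_nat -{2}(n_stuck_moved X0 tau A w) leq_addr.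
  exact: (stuck_fraction HF HX0 Hexp Hind HBpos HBinf Hsum M0 FM x_lt1).
- move=> /eventually_ge_of_limn_einf[c [N [c0 cF]]] F0 K.
  exact: (many_moved HF HX0 Hexp Hind K c0 cF F0).
Qed.
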